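(* Let $n\ge 1$. Let $\delta_i\in SOH(n)^d$, $0\le i\le n$, be the linear functionals with $\delta_i(H_j)=\delta_{i,j}$ (Kronecker delta), $0\le i,j\le n$. The linear map $\kappa:SOH(n)\to SOH(n)^d$ defined by $\kappa(H_i)=\delta_i$, $0\le i\le n$, is a complete order isomorphism that satisfies $$\Big\|\sum_{i=0}^n A_i\otimes\delta_i\Big\|_{cb}\le\Big\|\sum_{i=0}^n A_i\otimes H_i\Big\|\le 2\Big\|\sum_{i=0}^n A_i\otimes\delta_i\Big\|_{cb}$$ for any $m$ and any matrices $A_0,\dots,A_n\in M_m$, and $\|\kappa\|_{cb}\cdot\|\kappa^{-1}\|_{cb}=2$.
   Context: $OH(n)$ is Pisier's self-dual operator space of dimension $n$: it has an orthonormal basis $e_1,\dots,e_n$ with $\|\sum_{i=1}^n A_i\otimes e_i\|=\|\sum_{i=1}^n A_i\otimes\overline{A_i}\|^{1/2}$ for all $m$ and all $A_i\in M_m$, where $\overline{A}$ is the entrywise complex conjugate and the norm on the right is that of $M_m\otimes M_m=M_{m^2}$. Fix a completely isometric inclusion $OH(n)\subseteq B(\mathcal{H})$, so the $e_i$ are operators. Let $H_0$ be the identity of $B(\mathcal{H}\oplus\mathcal{H})$ and $H_i=\begin{pmatrix}0&e_i\\ e_i^*&0\end{pmatrix}$ for $1\le i\le n$. $SOH(n)\subseteq B(\mathcal{H}\oplus\mathcal{H})$ is the $(n+1)$-dimensional operator system spanned by $H_0,\dots,H_n$. For an operator system $\mathcal{S}$, $\mathcal{S}^d$ is the space of bounded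 linear functionals; $(f_{ij})\in M_m(\mathcal{S}^d)$ is identified with $F:\mathcal{S}\to M_m$, $F(v)=(f_{ij}(v))$; it is positive iff $F$ is completely positive, and its norm is $\|F\|_{cb}$. Thus $\sum_i A_i\otimes\delta_i$ is the map $X\mapsto\sum_i\delta_i(X)A_i$ from $SOH(n)$ to $M_m$. A complete order isomorphism is a linear bijection that is completely positive with completely positive inverse. *)

(* Defs.v *)
From HB Require Import structures.
From mathcomp Require Import all_boot all_order all_algebra.
From mathcomp Require Export complex mxtens.
From mathcomp Require Import all_classical all_reals all_analysis.

Set Implicit Arguments.
Unset Strict Implicit.
Unset Printing Implicit Defensive.

Import Order.TTheory GRing.Theory Num.Theory.
Import numFieldNormedType.Exports.

Local Open Scope classical_set_scope.
Local Open Scope ring_scope.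

(* Inner products are forms [d : {dot V for Num.conj}]: positive definite,
   linear in the first argument and conjugate-linear in the second. *)

Section DotSum.
Variables (R : realType) (V W : lmodType R[i]).
Variables (d : {dot V for Num.conj}) (d' : {dot W for Num.conj}).

Definition dot_sum (x y : V * W) : R[i] := d x.1 y.1 + d' x.2 y.2.

Let bil : bilinear_for *%R (Num.conj \; *%R) dot_sum.
Proof.
split=> [y|x] a u v.
  rewrite /dot_sum /= !linearPl /= mulrDr; exact: addrACA.
rewrite /dot_sum /= !linearPr /= mulrDr; exact: addrACA.
Qed.

HB.instance Definition _ := bilinear_isBilinear.Build _ _ _ _ _ _ dot_sum bil.

Let herm x y : dot_sum x y = (-1) ^+ false * Num.conj (dot_sum y x).
Proof.
rewrite /dot_sum rmorphD /= expr0 mul1r (hermC d) (hermC d').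
by rewrite !expr0 !mul1r.
Qed.

HB.instance Definition _ := isHermitianSesquilinear.Build _ _ _ _ dot_sum herm.

Let pos u : u != 0 -> 0 < dot_sum u u.
Proof.
move=> u0; rewrite lt_def /dot_sum addr_ge0 ?dnorm_ge0 // andbT.
rewrite paddr_eq0 ?dnorm_ge0 // !dnorm_eq0 negb_and.
apply: contraNT u0; rewrite negb_or !negbK => /andP[/eqP u1 /eqP u2].
by rewrite [u]surjective_pairing u1 u2.
Qed.

HB.instance Definition _ := isDotProduct.Build _ _ dot_sum pos.

End DotSum.

Section DotPow.
Variables (R : realType) (V : lmodType R[i]) (d : {dot V for Num.conj}).
Variable m : nat.

Definition dot_pow (x y : {ffun 'I_m -> V}) : R[i] := \sum_i d (x i) (y i).

Let bil : bilinear_for *%R (Num.conj \; *%R) dot_pow.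
Proof.
split=> [y|x] a u v; rewrite /dot_pow /= mulr_sumr -big_split /=;
  apply: eq_bigr => i _; by rewrite !ffunE ?linearPl ?linearPr.
Qed.

HB.instance Definition _ := bilinear_isBilinear.Build _ _ _ _ _ _ dot_pow bil.

Let herm x y : dot_pow x y = (-1) ^+ false * Num.conj (dot_pow y x).
Proof.
rewrite /dot_pow rmorph_sum expr0 mul1r; apply: eq_bigr => i _.
by rewrite (hermC d) expr0 mul1r.
Qed.

HB.instance Definition _ := isHermitianSesquilinear.Build _ _ _ _ dot_pow herm.

Let pos u : u != 0 -> 0 < dot_pow u u.
Proof.
move=> u0; rewrite lt_def /dot_pow sumr_ge0 ?andbT => [|i _]; last first.
  exact: dnorm_ge0.
apply: contraNN u0; rewrite psumr_eq0 => [/allP h|i _]; last exact: dnorm_ge0.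
apply/eqP/ffunP => i; apply/eqP; rewrite ffunE -(dnorm_eq0 d).
by have := h i; rewrite mem_index_enum => /(_ isT).
Qed.

HB.instance Definition _ := isDotProduct.Build _ _ dot_pow pos.

End DotPow.

Section DotCol.
Variables (R : realType) (m : nat).

Definition dot_col (x y : 'cV[R[i]]_m) : R[i] :=
  \sum_i x i ord0 * Num.conj (y i ord0).

Let bil : bilinear_for *%R (Num.conj \; *%R) dot_col.
Proof.
split=> [y|x] a u v; rewrite /dot_col /= mulr_sumr -big_split /=;
  apply: eq_bigr => i _; rewrite !mxE.
  by rewrite mulrDl mulrA.
by rewrite rmorphD rmorphM mulrDr mulrCA.
Qed.

HB.instance Definition _ := bilinear_isBilinear.Build _ _ _ _ _ _ dot_col bil.

Let herm x y : dot_col x y = (-1) ^+ false * Num.conj (dot_col y x).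
Proof.
rewrite /dot_col rmorph_sum expr0 mul1r; apply: eq_bigr => i _.
by rewrite rmorphM /= conjCK mulrC.
Qed.

HB.instance Definition _ := isHermitianSesquilinear.Build _ _ _ _ dot_col herm.

Let pos u : u != 0 -> 0 < dot_col u u.
Proof.
move=> u0; rewrite lt_def /dot_col sumr_ge0 ?andbT => [|i _]; last first.
  exact: mul_conjC_ge0.
apply: contraNN u0; rewrite psumr_eq0 => [/allP h|i _]; last first.
  exact: mul_conjC_ge0.
apply/eqP/matrixP => i j; rewrite ord1 mxE; apply/eqP; rewrite -mul_conjC_eq0.
by have := h i; rewrite mem_index_enum => /(_ isT).
Qed.

HB.instance Definition _ := isDotProduct.Build _ _ dot_col pos.

End DotCol.

Section Operators.
Variables (R : realType) (K : lmodType R[i]) (d : {dot K for Num.conj}).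

(* Operators on [K] are plain functions; [+oo] is the norm of an unbounded
   one. *)
Definition op_norm (T : K -> K) : \bar R :=
  ereal_sup [set (Num.sqrt (complex.Re (d (T x) (T x))))%:E
            | x in [set x | d x x <= 1]].

(* The order of [R[i]] makes [0 <= z] mean that [z] is real and
   nonnegative. *)
Definition op_pos (T : K -> K) : Prop := forall x, 0 <= d (T x) x.

Definition adjoint (T : K -> K) : K -> K :=
  xget (fun=> 0) [set S | forall x y, d (T x) y = d x (S y)].

(* An [m x m] matrix of operators on [K] as an operator on [K^m]. *)
Definition mxop m (X : 'M[K -> K]_m) (x : {ffun 'I_m -> K}) :
    {ffun 'I_m -> K} :=
  [ffun a => \sum_b X a b (x b)].

End Operators.

(* [\sum_i A_i (x) v_i] in [M_m(V)]. *)
Definition tens_sum (R : realType) (V : lmodType R[i]) (k m : nat)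
    (A : 'I_k -> 'M[R[i]]_m) (v : 'I_k -> V) : 'M[V]_m :=
  \matrix_(a, b) \sum_i A i a b *: v i.

(* The data carried by an operator system or by the dual of one: a norm and a
   positive cone on each [M_m(V)]. *)
Record opspace (R : realType) := OpSpace {
  os_sort :> lmodType R[i];
  os_norm : forall m, 'M[os_sort]_m -> \bar R;
  os_pos : forall m, 'M[os_sort]_m -> Prop }.

(* The structure on [V] inherited from operators on [K] through [r]. *)
Definition concrete_opspace (R : realType) (K : lmodType R[i])
    (d : {dot K for Num.conj}) (V : lmodType R[i]) (r : V -> K -> K) :
    opspace R :=
  @OpSpace R V (fun m X => op_norm (@dot_pow R _ d m) (mxop (map_mx r X)))
               (fun m X => op_pos (@dot_pow R _ d m) (mxop (map_mx r X))).

Definition mx_opspace (R : realType) (m : nat) : opspace R :=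
  concrete_opspace (@dot_col R m) (V := 'M[R[i]]_m)
    (fun A => (mulmx A : 'cV_m -> 'cV_m)).

Section Maps.
Variables (R : realType) (S T : opspace R).

Definition cb_norm (f : S -> T) : \bar R :=
  ereal_sup [set y | exists m (X : 'M[S]_m),
    (os_norm X <= 1)%E /\ y = os_norm (map_mx f X)].

Definition completely_positive (f : S -> T) : Prop :=
  forall m (X : 'M[S]_m), os_pos X -> os_pos (map_mx f X).

End Maps.

Definition complete_order_iso (R : realType) (S T : opspace R)
    (f : {linear S -> T}) (g : {linear T -> S}) : Prop :=
  [/\ cancel f g, cancel g f, completely_positive f & completely_positive g].

Section Dual.
Variables (R : realType) (S : opspace R).

Definition bounded_functional : {pred S -> R[i]} := fun f => `[<
  scalar f /\ exists M : R[i], forall v : S,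
    (os_norm (const_mx v : 'M[S]_1) <= 1)%E -> `|f v| <= M >].

Let bounded_functional_submod : submod_closed bounded_functional.
Proof.
split=> [|a f g /asboolP[fl [M fM]] /asboolP[gl [N gN]]]; apply/asboolP; split.
- by move=> a u v; rewrite /= mulr0 addr0.
- by exists 0 => v _; rewrite normr0.
- move=> b u v.
  rewrite -[LHS]/(a * f (b *: u + v) + g (b *: u + v)).
  rewrite -[RHS]/(b * (a * f u + g u) + (a * f v + g v)) fl gl.
  by rewrite !mulrDr mulrCA addrACA.
- exists (`|a| * M + N) => v v1.
  rewrite (le_trans (ler_normD _ _)) // lerD ?gN //.
  by rewrite normrM ler_wpM2l ?fM.
Qed.

HB.instance Definition _ := GRing.isSubmodClosed.Build R[i] (S -> R[i])
  bounded_functional bounded_functional_submod.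

Record dual_type := Functional {
  functional :> S -> R[i]; _ : functional \in bounded_functional }.

HB.instance Definition _ := [isSub for functional].
HB.instance Definition _ := [Choice of dual_type by <:].
HB.instance Definition _ := [SubChoice_isSubLmodule of dual_type by <:].

(* [F = (f_ab)] in [M_m(S^d)] as the map [S -> M_m], [v |-> (f_ab v)]. *)
Definition mx_functional m (F : 'M[dual_type]_m) (v : S) : mx_opspace R m :=
  \matrix_(a, b) F a b v.

Definition dual : opspace R := @OpSpace R dual_type
  (fun m F => cb_norm (mx_functional F))
  (fun m F => completely_positive (mx_functional F)).

End Dual.

Section Span.
Variables (R : realType) (V : lmodType R[i]) (k : nat) (b : 'I_k -> V).

Definition lin_span : {pred V} :=
  fun v => `[< exists a : 'I_k -> R[i], v = \sum_i a i *: b i >].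

Let lin_span_submod : submod_closed lin_span.
Proof.
split=> [|c u v /asboolP[f ->] /asboolP[g ->]]; apply/asboolP.
  by exists (fun=> 0); rewrite big1 // => i _; rewrite scale0r.
exists (fun i => c * f i + g i); rewrite scaler_sumr -big_split /=.
by apply: eq_bigr => i _; rewrite scalerA scalerDl.
Qed.

HB.instance Definition _ := GRing.isSubmodClosed.Build R[i] V lin_span
  lin_span_submod.

Record span_type := InSpan { span_val :> V; _ : span_val \in lin_span }.

HB.instance Definition _ := [isSub for span_val].
HB.instance Definition _ := [Choice of span_type by <:].
HB.instance Definition _ := [SubChoice_isSubLmodule of span_type by <:].

Lemma mem_lin_span i : b i \in lin_span.
Proof.
apply/asboolP; exists (fun j => (j == i)%:R).
rewrite (bigD1 i) //= eqxx scale1r big1 ?addr0 // => j /negPf ->.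
by rewrite scale0r.
Qed.

Definition span_gen (i : 'I_k) : span_type := InSpan (mem_lin_span i).

End Span.

Section SOH.
Variables (R : realType) (H : lmodType R[i]) (d : {dot H for Num.conj}).
Variables (n : nat) (e : 'I_n -> H -> H).

(* [e] is the canonical orthonormal basis of [OH(n)], completely
   isometrically included in [B(H)]. *)
Definition OH_basis : Prop :=
  forall m (A : 'I_n -> 'M[R[i]]_m),
    op_norm (@dot_pow R _ d m) (mxop (tens_sum A e)) =
    sqrte (op_norm (@dot_col R (m * m))
             (mulmx (\sum_i A i *t map_mx Num.conj (A i)))).

Definition SOH_op (i : 'I_n.+1) : H * H -> H * H :=
  if unlift ord0 i is Some j
  then fun x => (e j x.2, adjoint d (e j) x.1)
  else id.

Definition SOH : opspace R :=
  concrete_opspace (dot_sum d d) (V := span_type SOH_op)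
    (@span_val _ _ _ SOH_op).

Definition SOH_gen (i : 'I_n.+1) : SOH := span_gen SOH_op i.

End SOH.

(* Main.v *)
From HB Require Import structures.
Require Import Defs.
From mathcomp Require Import all_boot all_order all_algebra ssrAC.
From mathcomp Require Import spectral sesquilinear.
From mathcomp Require Import all_classical all_reals all_analysis.
From mathcomp Require Import ring lra.

(** All the statements are about coefficient families A = (A_0, ..., A_n) of
    matrices.  [posS A] and [bndS A c] express positivity and squared norm of
    Σ A_i ⊗ H_i.  [posD A] expresses positivity of Σ A_i ⊗ δ_i, that is,
    Σ A_i ⊗ B_i >= 0 for every B with [posS B].  When a vector of C^m ⊗ C^k is
    read as a matrix X with the Hilbert-Schmidt norm, A_i ⊗ B_i becomes
    X |-> A_i X B_i^T.  The sum over i is [Psi A B], and [Phi A] is the case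
    B = conj A, whose norm is the square of the norm of Σ A_i ⊗ e_i
    ([OH_sqbound]).

    Order.  For hermitian A_i, the operator 1 ⊗ H_0 + Σ A_i ⊗ H_i (i >= 1) has
    the form [[1, T], [T^H, 1]] with T = Σ A_i ⊗ e_i, hence it is positive iff T
    is a contraction ([posS_unital]), iff [Phi A] is one.  That [posS A] implies
    [posD A] then amounts to 1 + Σ A_i ⊗ B_i >= 0 for contractive [Phi A] and
    [Phi B], which is Haagerup's Cauchy-Schwarz inequality ([haagerup]).
    Conversely, let r^2 be the norm of [Phi A] and test [posD A] on
    B = (1, conj A / r) and (1, - conj A / r): the numerical radius of the
    hermitian map [Phi A] is at most r, so r^2 <= r ([posD_unital_bnd]).  The
    case of a general A_0 follows from the case A_0 = 1 by writing
    A_0 + eps = E^H E and letting eps tend to 0 ([normalize]).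

    Norms.  If X = Σ A_i ⊗ H_i has norm at most c, then [[c, X], [X^H, c]] is
    positive.  A corner of the positive pairing of two such blocks bounds
    Σ A_i ⊗ B_i, which is the first inequality ([bndD_of_posS_block]).  For the
    second, A_0 is the value of Σ A_i ⊗ δ_i at H_0, and its value at
    Σ conj A_i ⊗ H_i / r (i >= 1) is [Phi A] / r, of norm r; so both summands of
    A_0 ⊗ H_0 + Σ A_i ⊗ H_i are bounded by the dual norm ([bndS_of_bndD]).  The
    element H_0 + H_j shows that 2 is attained: it is positive, so its image has
    norm 1, while its own norm is 2 ([bndS_sum_ge2]).

    That the adjoints in the H_i are genuine adjoints is Riesz representation
    ([adjoint_ex]). *)

Set Implicit Arguments.
Unset Strict Implicit.
Unset Printing Implicit Defensive.

Import Order.TTheory GRing.Theory Num.Theory.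
Import numFieldNormedType.Exports.
Local Open Scope classical_set_scope.
Local Open Scope complex_scope.
Local Open Scope ring_scope.

Local Notation Re := complex.Re.

(** * Real parts of inner products, and bounded maps *)

Lemma cReD (R : realType) (x y : R[i]) : Re (x + y) = Re x + Re y.
Proof. by case: x y => [? ?] [? ?]. Qed.
Lemma cReN (R : realType) (x : R[i]) : Re (- x) = - Re x.
Proof. by case: x. Qed.
Lemma cReZ (R : realType) (a : R) (x : R[i]) : Re (a%:C * x) = a * Re x.
Proof. by case: x => ? ? /=; rewrite mul0r subr0. Qed.
Lemma cRe_conj (R : realType) (x : R[i]) : Re (Num.conj x) = Re x.
Proof. by case: x. Qed.

Lemma cRe_sum (R : realType) (I : finType) (F : I -> R[i]) :
  Re (\sum_i F i) = \sum_i Re (F i).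
Proof. exact: (big_morph (@Re R) (@cReD R) (erefl (Re 0))). Qed.

Lemma ger0_Re_ge0 (R : realType) (x : R[i]) : 0 <= x -> 0 <= Re x.
Proof. by case: x => a b; rewrite lecE => /andP[]. Qed.

Section DotSpace.
Variables (R : realType) (V : lmodType R[i]) (d : {dot V for Num.conj}).
Definition sqnorm (x : V) : R := Re (d x x).
Definition redot (x y : V) : R := Re (d x y).

Lemma dotC x y : d x y = Num.conj (d y x).
Proof. by rewrite (hermC d) expr0 mul1r. Qed.
Lemma dotDl x y z : d (x + y) z = d x z + d y z.
Proof. exact: linearDl. Qed.
Lemma dotDr x y z : d z (x + y) = d z x + d z y.
Proof. exact: linearDr. Qed.
Lemma dotZl a x z : d (a *: x) z = a * d x z.
Proof. exact: linearZl_LR. Qed.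
Lemma dotZr a x z : d z (a *: x) = Num.conj a * d z x.
Proof. exact: linearZr. Qed.
Lemma dotNl x z : d (- x) z = - d x z.
Proof. exact: linearNl. Qed.
Lemma dotNr x z : d z (- x) = - d z x.
Proof. exact: linearNr. Qed.
Lemma dot0l z : d 0 z = 0.
Proof. exact: linear0l. Qed.
Lemma dot0r z : d z 0 = 0.
Proof. exact: linear0r. Qed.
Lemma dot_suml (I : finType) (F : I -> V) y : d (\sum_i F i) y = \sum_i d (F i) y.
Proof. exact: (big_morph (d^~ y) (fun u v => dotDl u v y) (dot0l y)). Qed.
Lemma dot_sumr (I : finType) (F : I -> V) y : d y (\sum_i F i) = \sum_i d y (F i).
Proof. exact: (big_morph (d y) (fun u v => dotDr u v y) (dot0r y)). Qed.
Lemma dotxx x : d x x = (sqnorm x)%:C.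
Proof.
by rewrite /sqnorm RRe_real // ger0_real // dnorm_ge0.
Qed.
Lemma sqnorm_ge0 x : 0 <= sqnorm x.
Proof. by rewrite -ler0c -dotxx dnorm_ge0. Qed.
Lemma sqnorm_eq0 x : (sqnorm x == 0) = (x == 0).
Proof. by rewrite -(dnorm_eq0 d) dotxx eq_complex /= eqxx andbT. Qed.
Lemma redotC x y : redot x y = redot y x.
Proof. by rewrite /redot dotC cRe_conj. Qed.
Lemma redotDl x y z : redot (x + y) z = redot x z + redot y z.
Proof. by rewrite /redot dotDl cReD. Qed.
Lemma redotDr x y z : redot z (x + y) = redot z x + redot z y.
Proof. by rewrite redotC redotDl !(redotC z). Qed.
Lemma redotZl (a : R) x y : redot (a%:C *: x) y = a * redot x y.
Proof. by rewrite /redot dotZl cReZ. Qed.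
Lemma redotZr (a : R) x y : redot x (a%:C *: y) = a * redot x y.
Proof. by rewrite redotC redotZl redotC. Qed.
Lemma redotNl x y : redot (- x) y = - redot x y.
Proof. by rewrite /redot dotNl cReN. Qed.
Lemma redotNr x y : redot y (- x) = - redot y x.
Proof. by rewrite redotC redotNl redotC. Qed.
Lemma redotxx x : redot x x = sqnorm x. Proof. by []. Qed.
Lemma sqnormD x y : sqnorm (x + y) = sqnorm x + sqnorm y + 2 * redot x y.
Proof. by rewrite -!redotxx redotDl !redotDr (redotC y x); ring. Qed.
Lemma sqnormN x : sqnorm (- x) = sqnorm x.
Proof. by rewrite -!redotxx redotNl redotNr opprK. Qed.
Lemma sqnormB x y : sqnorm (x - y) = sqnorm x + sqnorm y - 2 * redot x y.
Proof. by rewrite sqnormD sqnormN redotNr mulrN. Qed.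
Lemma sqnormZ (a : R) x : sqnorm (a%:C *: x) = a ^+ 2 * sqnorm x.
Proof. by rewrite -!redotxx redotZl redotZr mulrA expr2. Qed.
Lemma sqnorm0 : sqnorm 0 = 0.
Proof. by apply/eqP; rewrite sqnorm_eq0. Qed.
Lemma sqnormD_le x y : sqnorm (x + y) <= 2 * sqnorm x + 2 * sqnorm y.
Proof. have := sqnorm_ge0 (x - y); rewrite sqnormB sqnormD; lra. Qed.
Lemma dot_inj x y : (forall z, d z x = d z y) -> x = y.
Proof.
move=> h; apply/eqP; rewrite -subr_eq0 -(dnorm_eq0 d).
by rewrite dotDr dotNr h subrr.
Qed.
Lemma redot_le_mean x y : 2 * redot x y <= sqnorm x + sqnorm y.
Proof. by have := sqnorm_ge0 (x - y); rewrite sqnormB; lra. Qed.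
Lemma redot_sqr_le x y : (redot x y) ^+ 2 <= sqnorm x * sqnorm y.
Proof.
have [->|y0] := eqVneq y 0; first by rewrite sqnorm0 mulr0 /redot dot0r expr0n.
have Ny : 0 < sqnorm y by rewrite lt_def sqnorm_ge0 sqnorm_eq0 y0.
have := sqnorm_ge0 ((sqnorm y)%:C *: x - (redot x y)%:C *: y).
rewrite sqnormB !sqnormZ redotZl redotZr => h.
rewrite -subr_ge0 -(pmulr_rge0 _ Ny); apply: le_trans h _.
by rewrite le_eqVlt; apply/orP; left; apply/eqP; ring.
Qed.

(** Polarisation: 4 Re <L x, y> is the difference of the values of the form of L
    at x + y and x - y, which the parallelogram law bounds by
    2 r (|x|^2 + |y|^2).  Then y is taken proportional to L x. *)
Lemma numerical_radius (L : V -> V) (r : R) :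
  {morph L : x y / x + y} -> (forall (a : R) x, L (a%:C *: x) = a%:C *: L x) ->
  (forall x y, redot (L x) y = redot x (L y)) -> 0 <= r ->
  (forall x, `|redot (L x) x| <= r * sqnorm x) -> forall x, sqnorm (L x) <= r ^+ 2 * sqnorm x.
Proof.
move=> LD LZ Lsa r0 hr x.
(* This is the polarised bound at y = t L x; the best t is 1/r. *)
have key (t : R) : 4 * (t * sqnorm (L x)) <= 2 * r * (sqnorm x + t ^+ 2 * sqnorm (L x)).
  pose y := t%:C *: L x.
  have h1 := ler_normlW (hr (x + y)).
  have h2 := lerNnormlW (hr (x - y)).
  have LN : L (x - y) = L x - L y.
    apply: (addIr (L y)); rewrite subrK -LD subrK //.
  have E1 : redot (L x) y = t * sqnorm (L x) by rewrite redotZr.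
  have E2 : redot (L y) x = t * sqnorm (L x) by rewrite Lsa redotC.
  have E3 : sqnorm y = t ^+ 2 * sqnorm (L x) by rewrite sqnormZ.
  move: h1 h2; rewrite LD LN !(redotDl, redotDr, redotNl, redotNr) E1 E2 sqnormD sqnormB E3.
  lra.
have [r_eq0|rN0] := eqVneq r 0.
  have := key 1; rewrite r_eq0; have := sqnorm_ge0 (L x); lra.
have rp : 0 < r by rewrite lt_def rN0.
have := key r^-1.
have -> : 2 * r * (sqnorm x + r^-1 ^+ 2 * sqnorm (L x)) =
  (2 * r ^+ 2 * sqnorm x + 2 * sqnorm (L x)) / r by field.
rewrite (_ : 4 * (r^-1 * sqnorm (L x)) = (4 * sqnorm (L x)) / r); last by ring.
by rewrite ler_pM2r ?invr_gt0 //; lra.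
Qed.

(** A sesquilinear form that is real on the diagonal is hermitian, by
    polarisation at x + y and x + i y. *)
Lemma herm_of_pos (T : V -> V) : linear T -> (forall x, 0 <= d (T x) x) ->
  forall x y, d (T x) y = d x (T y).
Proof.
move=> lT pT x y.
have TD u v : T (u + v) = T u + T v by rewrite -[u]scale1r lT !scale1r.
have T0 : T 0 = 0 by apply: (addrI (T 0)); rewrite -TD !addr0.
have TZ a u : T (a *: u) = a *: T u by rewrite -[a *: u]addr0 lT T0 !addr0.
have Im0 u : complex.Im (d (T u) u) = 0 by exact: ger0_Im.
have := Im0 (x + y); have := Im0 (x + 'i%C *: y); have := Im0 x; have := Im0 y.
rewrite !TD !TZ !(dotDl, dotDr, dotZl, dotZr) (dotC x (T y)).
case: (d (T x) x) (d (T y) y) (d (T x) y) (d (T y) x) => [? ?] [? ?] [? ?] [? ?] /=.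
by move=> h1 h2 h3 h4; apply/eqP; rewrite eq_complex /=; apply/andP; split; apply/eqP; lra.
Qed.

(** |T x|^2 = Re <x, S T x>, and Cauchy-Schwarz cancels one factor |T x|. *)
Lemma sqbound_adjoint (T S : V -> V) (c : R) : (forall x y, redot (T x) y = redot x (S y)) ->
  0 <= c -> (forall x, sqnorm (S x) <= c * sqnorm x) -> forall x, sqnorm (T x) <= c * sqnorm x.
Proof.
move=> TS c0 hS x; have := redot_sqr_le x (S (T x)).
rewrite -TS redotxx => h.
have {}h : sqnorm (T x) ^+ 2 <= (c * sqnorm x) * sqnorm (T x).
  apply: le_trans h _; rewrite (mulrC c) -mulrA.
  by rewrite ler_wpM2l ?sqnorm_ge0.
have [->|T0] := eqVneq (sqnorm (T x)) 0; first by rewrite mulr_ge0 ?sqnorm_ge0.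
by rewrite -(ler_pM2r (x := sqnorm (T x))) ?lt_def ?T0 ?sqnorm_ge0 // -expr2.
Qed.

Lemma sqbound_redot (T : V -> V) (c : R) : 0 <= c ->
  (forall x, sqnorm (T x) <= c ^+ 2 * sqnorm x) -> forall x, redot (T x) x <= c * sqnorm x.
Proof.
move=> c0 hT x; apply: le_trans (ler_norm _) _.
rewrite -(ler_pXn2r (n := 2)) ?nnegrE ?mulr_ge0 ?sqnorm_ge0 //.
rewrite real_normK ?num_real //; apply: le_trans (redot_sqr_le _ _) _.
by rewrite exprMn [sqnorm x ^+ 2]expr2 mulrA ler_wpM2r ?sqnorm_ge0.
Qed.
End DotSpace.

(** The limit eps -> 0 for the only kind of dependence on eps that occurs. *)
Lemma ge0_eps (R : realType) (q r s : R) :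
  (forall eps, 0 < eps -> 0 <= q + eps * r + eps ^+ 2 * s) -> 0 <= q.
Proof.
move=> h; rewrite leNgt; apply/negP => q0.
pose k := `|r| + `|s| + 1.
have k0 : 0 < k by rewrite ltr_wpDl // addr_ge0.
(* With this t, the terms t * r and t ^+ 2 * s add up to less than - q / 2. *)
pose t := Num.min 1 (- q / (2 * k)).
have t0 : 0 < t by rewrite lt_min ltr01 divr_gt0 ?mulr_gt0 // oppr_gt0.
have t1 : t <= 1 by rewrite ge_min lexx.
have tk : t * k <= - q / 2.
  rewrite -ler_pdivlMr // ge_min; apply/orP; right.
  by rewrite le_eqVlt; apply/orP; left; apply/eqP; field; rewrite gt_eqF.
have h1 : t * r <= t * `|r| by rewrite ler_pM2l // ler_norm.
have h2 : t ^+ 2 * s <= t * `|s|.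
  rewrite expr2 -mulrA ler_pM2l //; apply: le_trans (ler_norm _) _.
  by rewrite normrM (gtr0_norm t0) ler_piMl.
have := h t t0; move: tk; rewrite /k !mulrDr mulr1 => tk h3.
have : 0 <= q + t * `|r| + t * `|s| by apply: le_trans h3 _; rewrite !lerD.
move: tk t0 q0; move: (t * `|r|) (t * `|s|) => a b; clear; lra.
Qed.

Section OpNorm.
Variables (R : realType) (V : lmodType R[i]) (d : {dot V for Num.conj}).

(** Bounds are on squared norms, so that no square roots appear. *)
Definition sqbound (T : V -> V) (c : R) := forall x, sqnorm d (T x) <= c * sqnorm d x.

Lemma sqbound_le (T : V -> V) c c' : c <= c' -> sqbound T c -> sqbound T c'.
Proof.
by move=> cc h x; apply: le_trans (h x) _; rewrite ler_wpM2r ?sqnorm_ge0.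
Qed.

Lemma op_norm_leE (T : V -> V) c : (forall (a : R) x, T (a%:C *: x) = a%:C *: T x) ->
  0 <= c -> (op_norm d T <= c%:E)%E <-> sqbound T (c ^+ 2).
Proof.
move=> hT c0; split=> [le_c x|hb].
- have [->|x0] := eqVneq x 0.
    have := hT 0 0; rewrite !scale0r => ->.
    by rewrite sqnorm0 mulr0.
  have nx : 0 < sqnorm d x by rewrite lt_def sqnorm_ge0 sqnorm_eq0 x0.
  set s := Num.sqrt (sqnorm d x); have s0 : 0 < s by rewrite sqrtr_gt0.
  have s2 : s ^+ 2 = sqnorm d x by rewrite sqr_sqrtr // ltW.
  have {le_c} : Num.sqrt (Re (d (T (s^-1%:C *: x)) (T (s^-1%:C *: x)))) <= c.
    rewrite -lee_fin; apply: le_trans le_c; apply: ereal_sup_ubound.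
    exists (s^-1%:C *: x) => //=.
    by rewrite dotxx sqnormZ exprVn s2 mulVf ?gt_eqF // lexx.
  rewrite -/(sqnorm d _) hT sqnormZ exprVn s2 -(ler_pXn2r (n:=2)) ?nnegrE ?sqrtr_ge0 //.
  rewrite sqr_sqrtr; first by rewrite mulrC ler_pdivrMr.
  by rewrite mulr_ge0 ?sqnorm_ge0 // invr_ge0 sqnorm_ge0.
- apply: ge_ereal_sup => _ [x /= x1 <-]; rewrite lee_fin.
  rewrite -(ler_pXn2r (n:=2)) ?nnegrE ?sqrtr_ge0 // sqr_sqrtr ?sqnorm_ge0 //.
  apply: le_trans (hb x) _; rewrite ler_piMr ?sqr_ge0 //.
  by rewrite -lecR -dotxx.
Qed.

Lemma op_norm_ge0 (T : V -> V) : (0 <= op_norm d T)%E.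
Proof.
apply: (@le_trans _ _ (Num.sqrt (Re (d (T 0) (T 0))))%:E).
  by rewrite lee_fin sqrtr_ge0.
by apply: ereal_sup_ubound; exists 0 => //=; rewrite dot0l ler01.
Qed.
End OpNorm.
Lemma addC_conj (R : realType) (z : R[i]) : z + Num.conj z = (2 * Re z)%:C.
Proof.
case: z => a b; apply/eqP; rewrite eq_complex /=.
by apply/andP; split; apply/eqP; ring.
Qed.

Lemma ge0_conj (R : realType) (z : R[i]) : Num.conj z = z -> 0 <= Re z -> 0 <= z.
Proof.
case: z => a b /= [] h a0; rewrite lecE /= a0 andbT eq_sym; apply/eqP; lra.
Qed.

Lemma conj_form_sum (R : realType) (c a b : R) (z : R[i]) :
  c%:C * a%:C + z + (Num.conj z + c%:C * b%:C) = (c * a + c * b + 2 * Re z)%:C.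
Proof.
case: z => p q; apply/eqP; rewrite eq_complex /=.
by apply/andP; split; apply/eqP; ring.
Qed.

Lemma norm_le_of_signs (R : realType) (a b : R) :
  0 <= a + b -> 0 <= a - b -> `|b| <= a.
Proof. by move=> h1 h2; rewrite ler_norml; apply/andP; split; lra. Qed.

Lemma ge_of_le_bounds (R : realType) (N : \bar R) (b : R) : 0 < b ->
  (forall c : R, 0 <= c -> (N <= c%:E)%E -> b <= c) -> (b%:E <= N)%E.
Proof.
move=> b0 h; case: N h => [r| |] h.
- have := h (Num.max r 0); rewrite le_max lexx orbT lee_fin le_max lexx.
  move=> /(_ isT isT); rewrite le_max => /orP[] //.
  by move=> b1; have := lt_le_trans b0 b1; rewrite ltxx.
- exact: leey.
- by have := h 0 (lexx _) (leNye _); rewrite leNgt b0.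
Qed.

Lemma addr5 (V : nmodType) (a b c p q : V) :
  a + b + (c + q) + p = a + p + c + b + q.
Proof. by rewrite (AC ((2*2)*1) (1*5*3*2*4)). Qed.

Section RealAux.
Variables (R : realType).
Implicit Types c p q r t s : R.
Lemma block_bound c p q r t : r <= c ^+ 2 * q ->
  c ^+ 2 * p + r + 2 * (c * t) <= c * (c * p + c * q + 2 * t).
Proof. by move=> h; lra. Qed.
Lemma shifted_bound c p q r : p + q + 2 * r <= c * (p + q) ->
  2 * r <= (c - 1) * (q + p).
Proof. by move=> h; lra. Qed.
Lemma sq_cancel s p q : 2 * q <= s ^+ 2 * p + q -> q <= s ^+ 2 * p.
Proof. by move=> h; lra. Qed.
Lemma mean_bound p q t : p <= 1 * q -> 2 * t <= p + q -> t <= q.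
Proof. by move=> *; lra. Qed.
Lemma opp_bound p t : 2 * - t <= p -> - p <= 2 * t.
Proof. by move=> *; lra. Qed.
Lemma sum_bound c p q r s t : r + s <= 2 * c -> p <= r -> q <= s ->
  - (p + q) <= 2 * t -> - c <= t.
Proof. by move=> *; lra. Qed.
Lemma nonpos_bound s p q : s <= 0 -> 0 <= p -> 0 <= q -> 2 * q <= s * (p + q) ->
  q <= 0.
Proof. by move=> *; nra. Qed.
End RealAux.

(** * Riesz representation and existence of adjoints *)

Section Riesz.
Variables (R : realType) (H : completeNormedModType R[i]).
Variables (d : {dot H for Num.conj}).
Hypothesis hd : forall x : H, `|x| ^+ 2 = d x x.
Local Notation C := R[i].

Lemma norm_lt_sqnorm (x : H) (e : C) : 0 < e -> sqnorm d x < (Re e) ^+ 2 -> `|x| < e.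
Proof.
move=> e0; have eE : e = (Re e)%:C by rewrite RRe_real // gtr0_real.
rewrite -ltcR rmorphXn /= -eE /= => h.
by rewrite -(ltr_pXn2r (n:=2)) ?nnegrE ?(ltW e0) // hd dotxx.
Qed.

Lemma sqnorm_lt_norm (x : H) (e : R) : 0 < e -> `|x| < e%:C -> sqnorm d x < e ^+ 2.
Proof.
move=> e0 h; rewrite -ltcR rmorphXn /= -dotxx -hd.
by rewrite ltr_pXn2r ?nnegrE ?ler0c ?normr_ge0 ?(ltW e0).
Qed.

(** The representing vector minimises |x|^2 - 2 Re (f x).  By the parallelogram
    law a minimising sequence is Cauchy; the first variation of the functional
    tends to 0 along it, so its limit y satisfies Re <y, x> = Re (f x), and
    replacing x by i x gives the imaginary parts. *)
Lemma riesz (f : H -> C) (M : R) : scalar f -> 0 <= M ->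
  (forall x, (Re (f x)) ^+ 2 <= M * sqnorm d x) -> exists y, forall x, f x = d x y.
Proof.
move=> lf M0 hM.
have fD u v : f (u + v) = f u + f v.
  by rewrite -[u]scale1r lf mul1r scale1r.
have f0 : f 0 = 0 by apply: (addrI (f 0)); rewrite -fD !addr0.
have fZ a u : f (a *: u) = a * f u.
  by rewrite -[a *: u]addr0 lf f0 !addr0.
pose phi x := sqnorm d x - 2 * Re (f x).
have phi_lb x : - M <= phi x.
  have h : 2 * Re (f x) <= sqnorm d x + M.
    apply: (@le_trans _ _ `|2 * Re (f x)|); first exact: ler_norm.
    rewrite -(ler_pXn2r (n:=2)) ?nnegrE ?addr_ge0 ?sqnorm_ge0 //.
    rewrite real_normK ?num_real //; have := hM x; have := sqr_ge0 (sqnorm d x - M).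
    by rewrite !expr2; nra.
  by rewrite /phi; lra.
pose E := range phi; pose mm := inf E.
have Einf : has_inf E.
  split; first by exists (phi 0), 0.
  by exists (- M) => _ [x _ <-].
have phi_ge x : mm <= phi x by apply: (ge_inf Einf.2); exists x.
have /choice[u hu] (n : nat) : exists x, phi x < mm + n.+1%:R^-1.
  have [|_ [x _ <-] hx] := @inf_adherent _ E n.+1%:R^-1 _ Einf.
    by rewrite invr_gt0.
  by exists x.
have phiD x y (t : R) : phi (x + t%:C *: y) =
    phi x + t ^+ 2 * sqnorm d y + 2 * t * (redot d x y - Re (f y)).
  by rewrite /phi sqnormD sqnormZ redotZr fD fZ cReD cReZ; ring.
have par x y : sqnorm d (x - y) <= 2 * (phi x - mm) + 2 * (phi y - mm).
  have := phi_ge (2^-1%:C *: x + 2^-1%:C *: y).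
  rewrite -scalerDr /phi sqnormZ sqnormB sqnormD fZ fD cReZ cReD.
  rewrite (_ : 2^-1 ^+ 2 = 4^-1 :> R); last by field.
  by lra.
have small (e : R) : 0 < e -> exists N, forall n, (N <= n)%N -> (n.+1%:R : R)^-1 < e.
  move=> e0; have [N _ hN] := (near_infty_natSinv_lt (PosNum e0)).
  by exists N => n; exact: hN.
have ucau : cauchy_ex (u @ \oo).
  move=> e e0; have eE : e = (Re e)%:C by rewrite RRe_real // gtr0_real.
  have e'0 : 0 < Re e by rewrite -ltcR -eE.
  have [|N hN] := small (Re e ^+ 2 / 4); first by rewrite divr_gt0 // exprn_gt0.
  exists (u N); exists N => // n /= Nn; rewrite -ball_normE /ball_ /=.
  apply: norm_lt_sqnorm => //; apply: le_lt_trans (par _ _) _.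
  have := hu n; have := hu N; have := hN n Nn; have := hN N (leqnn N).
  move: (phi (u N)) (phi (u n)) (n.+1%:R^-1) (N.+1%:R^-1) => a b p q; lra.
have /cauchy_cvg/cvg_ex[x ux] : cauchy (u @ \oo) by exact: cauchy_exP.
exists x.
have key y : redot d x y = Re (f y).
  suff h (e : R) : 0 < e -> (redot d x y - Re (f y)) ^+ 2 <= 4 * sqnorm d y * e.
    apply/eqP; rewrite -subr_eq0 -sqrf_eq0 eq_le sqr_ge0 andbT.
    apply/ler_addgt0Pr => e e0; rewrite add0r.
    have N0 := sqnorm_ge0 d y.
    have k0 : 0 < 4 * sqnorm d y + 1 by lra.
    apply: le_trans (h _ (divr_gt0 e0 k0)) _.
    by rewrite mulrA ler_pdivrMr // mulrC ler_pM2l //; lra.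
  move=> e0.
  have [N1 hN1] := small e e0.
  have s0 : 0 < Num.sqrt e by rewrite sqrtr_gt0.
  have [N2 _ hN2] : \forall n \near \oo, `|x - u n| < (Num.sqrt e)%:C.
    by move/cvgrPdist_lt : ux; apply; rewrite ltcR.
  set n := maxn N1 N2.
  have e1 := hN1 n (leq_maxl _ _).
  have := hN2 n (leq_maxr _ _) => /= /(sqnorm_lt_norm s0).
  rewrite (sqr_sqrtr (ltW e0)) => e2.
  (* The minimum over t of phi (u n + t y) is not below mm, while phi (u n) is
     within 1/(n+1) of mm. *)
  have g1 : (redot d (u n) y - Re (f y)) ^+ 2 <= n.+1%:R^-1 * sqnorm d y.
    set g := _ - _.
    have [y0|y0] := eqVneq (sqnorm d y) 0.
      have : y = 0 by apply/eqP; rewrite -(sqnorm_eq0 d) y0.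
      by rewrite /g => ->; rewrite f0 sqnorm0 /redot dot0r subrr expr0n mulr0.
    have Ny : 0 < sqnorm d y by rewrite lt_def sqnorm_ge0 y0.
    have := phi_ge (u n + (- g / sqnorm d y)%:C *: y); rewrite phiD -/g.
    have -> : phi (u n) + (- g / sqnorm d y) ^+ 2 * sqnorm d y + 2 * (- g / sqnorm d y) * g
      = phi (u n) - g ^+ 2 / sqnorm d y by field.
    move=> h; have := hu n => h2.
    rewrite -ler_pdivrMr //; move: h h2.
    by move: (phi (u n)) (g ^+ 2 / sqnorm d y) (n.+1%:R^-1) => p q r; lra.
  have g2 := redot_sqr_le d (x - u n) y.
  have -> : redot d x y - Re (f y) = (redot d (u n) y - Re (f y)) + redot d (x - u n) y.
    by rewrite redotDl redotNl; ring.
  set a := _ - _ in g1 *; set b := redot _ _ _ in g2 *.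
  have : (a + b) ^+ 2 <= 2 * a ^+ 2 + 2 * b ^+ 2.
    by rewrite -subr_ge0 (_ : _ - _ = (a - b) ^+ 2) ?sqr_ge0 //; ring.
  move/le_trans; apply.
  have N0 := sqnorm_ge0 d y.
  have {}g1 : a ^+ 2 <= e * sqnorm d y.
    by apply: le_trans g1 _; rewrite ler_wpM2r // ltW.
  have {}g2 : b ^+ 2 <= e * sqnorm d y.
    by apply: le_trans g2 _; rewrite ler_wpM2r // ltW.
  by move: g1 g2; move: (a ^+ 2) (b ^+ 2) (sqnorm d y) => p q r; lra.
move=> y; apply/eqP; rewrite eq_complex; apply/andP; split; apply/eqP.
  by rewrite -key redotC.
have := key ('i%C *: y); rewrite redotC /redot dotZl fZ.
case: (d y x) (f y) => [a b] [a' b'] /=; lra.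
Qed.

(** [adjoint] is defined by choice, with value the zero map if there is no adjoint;
    Riesz representation excludes this for bounded operators. *)
Lemma adjoint_ex (T : H -> H) (M : R) : linear T -> 0 <= M -> sqbound d T M ->
  forall x y, d (T x) y = d x (adjoint d T y).
Proof.
move=> lT M0 hT.
suff [S hS] : exists S, forall x y, d (T x) y = d x (S y).
  by rewrite /adjoint; case: xgetP => [S' _ //|/(_ S)].
suff h y : exists z, forall x, d (T x) y = d x z.
  have [S hS] := choice h; exists S => x y; exact: hS.
apply: (@riesz _ (M * sqnorm d y)); last 1 first.
- move=> x; apply: le_trans (redot_sqr_le _ _ _) _.
  by rewrite mulrAC ler_wpM2r ?sqnorm_ge0 // hT.
- by move=> a u v; rewrite lT dotDl dotZl.
- by rewrite mulr_ge0 ?sqnorm_ge0.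
Qed.
End Riesz.

(** * Matrices with the Hilbert-Schmidt form *)

Local Notation "A ^H" := (map_mx Num.conj A^T) (at level 8, format "A ^H").

Section Adj.
Variable R : realType.
Implicit Types m n p : nat.
Local Notation C := R[i].
Lemma adjK m n (A : 'M[C]_(m, n)) : A^H^H = A.
Proof. by apply/matrixP=> i j; rewrite !mxE conjCK. Qed.
Lemma adjM m n p (A : 'M[C]_(m, n)) (B : 'M[C]_(n, p)) :
  (A *m B)^H = B^H *m A^H.
Proof. by rewrite trmx_mul map_mxM. Qed.
Lemma adjD m n (A B : 'M[C]_(m, n)) : (A + B)^H = A^H + B^H.
Proof. by rewrite linearD map_mxD. Qed.
Lemma adjZ m n a (A : 'M[C]_(m, n)) : (a *: A)^H = Num.conj a *: A^H.
Proof. by rewrite linearZ map_mxZ. Qed.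
Lemma adj1 m : (1%:M : 'M[C]_m)^H = 1%:M.
Proof. by rewrite trmx1 map_mx1. Qed.
Lemma conj_mxK m n (A : 'M[C]_(m, n)) : map_mx Num.conj (map_mx Num.conj A) = A.
Proof. by apply/matrixP=> i j; rewrite !mxE conjCK. Qed.
Lemma conj_realC (a : R) : Num.conj a%:C = a%:C.
Proof. exact: conjc_real. Qed.
End Adj.

Section DotMx.
Variables (R : realType) (m n : nat).
Local Notation C := R[i].

Definition dot_mx (X Y : 'M[C]_(m, n)) : C := \tr (X *m Y^H).

Lemma dot_mxE X Y : dot_mx X Y = \sum_i \sum_j X i j * Num.conj (Y i j).
Proof.
apply: eq_bigr => i _; rewrite mxE; apply: eq_bigr => j _.
by rewrite !mxE.
Qed.

Let bil : bilinear_for *%R (Num.conj \; *%R) dot_mx.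
Proof.
split=> [y|x] a u v; rewrite /dot_mx.
  by rewrite mulmxDl -scalemxAl linearD linearZ.
by rewrite adjD adjZ mulmxDr -scalemxAr linearD linearZ.
Qed.

HB.instance Definition _ := bilinear_isBilinear.Build _ _ _ _ _ _ dot_mx bil.

Let herm x y : dot_mx x y = (-1) ^+ false * Num.conj (dot_mx y x).
Proof.
rewrite expr0 mul1r !dot_mxE rmorph_sum; apply: eq_bigr => i _.
by rewrite rmorph_sum; apply: eq_bigr => j _; rewrite rmorphM /= conjCK mulrC.
Qed.

HB.instance Definition _ := isHermitianSesquilinear.Build _ _ _ _ dot_mx herm.

Let pos u : u != 0 -> 0 < dot_mx u u.
Proof.
have h i : 0 <= \sum_j u i j * Num.conj (u i j).
  by apply: sumr_ge0 => j _; exact: mul_conjC_ge0.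
move=> u0; rewrite lt_def dot_mxE sumr_ge0 ?andbT //.
apply: contraNN u0; rewrite psumr_eq0 // => /allP h1.
apply/eqP/matrixP => i j; rewrite mxE; apply/eqP; rewrite -mul_conjC_eq0.
have := h1 i; rewrite mem_index_enum => /(_ isT) /=.
rewrite psumr_eq0 => [/allP h2|k _]; last exact: mul_conjC_ge0.
by have := h2 j; rewrite mem_index_enum => /(_ isT).
Qed.

HB.instance Definition _ := isDotProduct.Build _ _ dot_mx pos.
End DotMx.
Arguments dot_mx {R m n} X Y.

Section DotMxTheory.
Variable R : realType.
Implicit Types m n p : nat.
Local Notation C := R[i].

Lemma dot_mx_mull m n p (A : 'M[C]_(m, p)) (X : 'M[C]_(p, n)) Y :
  dot_mx (A *m X) Y = dot_mx X (A^H *m Y).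
Proof. by rewrite /dot_mx adjM adjK mulmxA -mulmxA mxtrace_mulC. Qed.
Lemma dot_mx_mulr m n p (B : 'M[C]_(p, n)) (X : 'M[C]_(m, p)) Y :
  dot_mx (X *m B) Y = dot_mx X (Y *m B^H).
Proof. by rewrite /dot_mx adjM adjK mulmxA. Qed.
Lemma dot_mx_adj m n (X Y : 'M[C]_(m, n)) : dot_mx X^H Y^H = dot_mx Y X.
Proof. by rewrite /dot_mx adjK mxtrace_mulC. Qed.
Lemma dot_mx_conj m n (X Y : 'M[C]_(m, n)) :
  dot_mx (map_mx Num.conj X) (map_mx Num.conj Y) = Num.conj (dot_mx X Y).
Proof.
rewrite !dot_mxE rmorph_sum; apply: eq_bigr => i _.
by rewrite rmorph_sum; apply: eq_bigr => j _; rewrite rmorphM !mxE.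
Qed.
Lemma sqnorm_adj m n (X : 'M[C]_(m, n)) : sqnorm dot_mx X^H = sqnorm dot_mx X.
Proof. by rewrite -[LHS]/(Re (dot_mx _ _)) dot_mx_adj. Qed.
Lemma sqnorm_conjmx m n (X : 'M[C]_(m, n)) :
  sqnorm dot_mx (map_mx Num.conj X) = sqnorm dot_mx X.
Proof. by rewrite -[LHS]/(Re (dot_mx _ _)) dot_mx_conj cRe_conj. Qed.

(** The operator Σ A_i ⊗ B_i, a vector of the tensor product being read as a
    matrix. *)
Definition Psi k m n p q (A : 'I_k -> 'M[C]_(m, n)) (B : 'I_k -> 'M[C]_(p, q))
    (X : 'M[C]_(n, q)) : 'M[C]_(m, p) := \sum_i A i *m X *m (B i)^T.
Definition Phi k m n (A : 'I_k -> 'M[C]_(m, n)) (X : 'M[C]_n) : 'M[C]_m :=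
  \sum_i A i *m X *m (A i)^H.

Definition vec m n (X : 'M[C]_(m, n)) : 'cV[C]_(m * n) :=
  \col_k X (mxtens_unindex k).1 (mxtens_unindex k).2.
Definition unvec m n (x : 'cV[C]_(m * n)) : 'M[C]_(m, n) :=
  \matrix_(i, j) x (mxtens_index (i, j)) ord0.

Lemma vecK m n : cancel (@vec m n) (@unvec m n).
Proof. by move=> X; apply/matrixP=> i j; rewrite !mxE mxtens_indexK. Qed.
Lemma unvecK m n : cancel (@unvec m n) (@vec m n).
Proof.
move=> x; apply/matrixP=> i j; rewrite !mxE (ord1 j) -[in RHS](mxtens_unindexK i).
by case: (mxtens_unindex i).
Qed.

Lemma sum_tens (V : nmodType) m n (F : 'I_(m * n) -> V) :
  \sum_k F k = \sum_i \sum_j F (mxtens_index (i, j)).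
Proof.
rewrite pair_bigA /= (reindex (@mxtens_index m n)) /=.
  by apply: eq_bigr => -[].
by exists (@mxtens_unindex m n) => i _; rewrite ?mxtens_indexK ?mxtens_unindexK.
Qed.

Lemma dot_col_vec m n (X Y : 'M[C]_(m, n)) :
  @dot_col R _ (vec X) (vec Y) = dot_mx X Y.
Proof.
rewrite dot_mxE /dot_col sum_tens; apply: eq_bigr => i _; apply: eq_bigr => j _.
by rewrite !mxE mxtens_indexK.
Qed.

Lemma tens_vec m n p q (A : 'M[C]_(m, n)) (B : 'M[C]_(p, q)) (X : 'M[C]_(n, q)) :
  (A *t B) *m vec X = vec (A *m X *m B^T).
Proof.
apply/matrixP=> k j; rewrite !mxE -(mxtens_unindexK k).
case: (mxtens_unindex k) => a b; rewrite mxtens_indexK /= sum_tens exchange_big.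
apply: eq_bigr => i _; rewrite mxE mulr_suml; apply: eq_bigr => l _.
by rewrite tensmxE !mxE mxtens_indexK /=; ring.
Qed.

Lemma Phi_vec k m (A : 'I_k -> 'M[C]_m) X :
  (\sum_i A i *t map_mx Num.conj (A i)) *m vec X = vec (Phi A X).
Proof.
apply: (can_inj (@unvecK m m)); rewrite vecK mulmx_suml /Phi.
under eq_bigr do rewrite tens_vec.
apply/matrixP => i j; rewrite mxE !summxE; apply: eq_bigr => l _.
rewrite !mxE mxtens_indexK /=; apply: eq_bigr => r _; congr (_ * _).
by rewrite !mxE.
Qed.

Definition mx_of_cols k m (z : {ffun 'I_k -> 'cV[C]_m}) : 'M[C]_(m, k) :=
  \matrix_(p, b) z b p ord0.
Definition cols_of_mx k m (X : 'M[C]_(m, k)) : {ffun 'I_k -> 'cV[C]_m} :=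
  [ffun b => col b X].
Lemma cols_of_mxK k m : cancel (@cols_of_mx k m) (@mx_of_cols k m).
Proof. by move=> X; apply/matrixP=> i j; rewrite !mxE ffunE mxE. Qed.
Lemma dot_pow_cols k m (z w : {ffun 'I_k -> 'cV[C]_m}) :
  dot_pow (@dot_col R m) z w = dot_mx (mx_of_cols z) (mx_of_cols w).
Proof.
rewrite dot_mxE /dot_pow exchange_big; apply: eq_bigr => i _.
by apply: eq_bigr => j _; rewrite !mxE.
Qed.
End DotMxTheory.

Section DotMxMore.
Variables (R : realType) (m n : nat).
Local Notation K := R[i].
Implicit Types x y z : 'M[K]_(m, n).
Lemma dot_mxDl x y z : dot_mx (x + y) z = dot_mx x z + dot_mx y z.
Proof. exact: (dotDl (@dot_mx R m n)). Qed.
Lemma dot_mxZl a x z : dot_mx (a *: x) z = a * dot_mx x z.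
Proof. exact: (dotZl (@dot_mx R m n)). Qed.
Lemma dot_mxNl x z : dot_mx (- x) z = - dot_mx x z.
Proof. exact: (dotNl (@dot_mx R m n)). Qed.
Lemma dot_mxC x y : dot_mx x y = Num.conj (dot_mx y x).
Proof. exact: (dotC (@dot_mx R m n)). Qed.
Lemma dot_mxxx x : dot_mx x x = (sqnorm (@dot_mx R m n) x)%:C.
Proof. exact: (dotxx (@dot_mx R m n)). Qed.
End DotMxMore.

Section Blocks.
Variable R : realType.
Local Notation K := R[i].
Variables m1 m2 n1 n2 : nat.

Lemma sum_block k (A : 'I_k -> 'M[K]_(m1, n1)) (B : 'I_k -> 'M[K]_(m1, n2))
   (C : 'I_k -> 'M[K]_(m2, n1)) (D : 'I_k -> 'M[K]_(m2, n2)) :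
  \sum_i block_mx (A i) (B i) (C i) (D i) =
  block_mx (\sum_i A i) (\sum_i B i) (\sum_i C i) (\sum_i D i).
Proof.
apply/matrixP => i j; rewrite summxE.
have [i' ->|i' ->] := split_ordP i; have [j' ->|j' ->] := split_ordP j;
  rewrite ?(block_mxEul, block_mxEur, block_mxEdl, block_mxEdr) summxE;
  by apply: eq_bigr => l _; rewrite ?(block_mxEul, block_mxEur, block_mxEdl, block_mxEdr).
Qed.

Lemma dot_block_diag (A X : 'M[K]_(m1, n1)) B C (D Y : 'M[K]_(m2, n2)) :
  dot_mx (block_mx A B C D) (block_mx X 0 0 Y) = dot_mx A X + dot_mx D Y.
Proof.
rewrite /dot_mx tr_block_mx map_block_mx mulmx_block mxtrace_block.
by rewrite !trmx0 !map_mx0 !mulmx0 addr0 add0r.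
Qed.
End Blocks.

(** * Matrix families acting on vectors *)

Local Notation dpw d := (@dot_pow _ _ d _).

Section Amp.
Variable R : realType.
Local Notation C := R[i].

(** The operator Σ A_i ⊗ f_i from U^m to W^p. *)
Definition amp k p m (U W : lmodType C) (A : 'I_k -> 'M[C]_(p, m))
    (f : 'I_k -> U -> W) (x : {ffun 'I_m -> U}) : {ffun 'I_p -> W} :=
  [ffun a => \sum_b \sum_i A i a b *: f i (x b)].

(** The operator A ⊗ 1. *)
Definition scal p m (U : lmodType C) (A : 'M[C]_(p, m))
   (x : {ffun 'I_m -> U}) : {ffun 'I_p -> U} :=
  [ffun a => \sum_b A a b *: x b].

Lemma amp_adj k p m (U W : lmodType C) (dU : {dot U for Num.conj})
   (dW : {dot W for Num.conj}) (A : 'I_k -> 'M[C]_(p, m))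
   (f : 'I_k -> U -> W) (g : 'I_k -> W -> U) :
  (forall i x y, dW (f i x) y = dU x (g i y)) -> forall x y,
  dot_pow dW (amp A f x) y = dot_pow dU x (amp (fun i => (A i)^H) g y).
Proof.
move=> h x y; rewrite /dot_pow.
transitivity (\sum_a \sum_b \sum_i A i a b * dW (f i (x b)) (y a)).
  apply: eq_bigr => a _; rewrite ffunE dot_suml; apply: eq_bigr => b _.
  rewrite dot_suml; apply: eq_bigr => i _.
  by rewrite dotZl.
rewrite exchange_big; apply: eq_bigr => b _.
rewrite ffunE dot_sumr; apply: eq_bigr => a _.
rewrite dot_sumr; apply: eq_bigr => i _.
by rewrite dotZr !mxE conjCK h.
Qed.

Lemma amp_linear k p m (U W : lmodType C) (A : 'I_k -> 'M[C]_(p, m))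
    (f : 'I_k -> U -> W) : (forall i, linear (f i)) -> linear (amp A f).
Proof.
move=> lf c x y; apply/ffunP => a; rewrite !ffunE scaler_sumr -big_split.
apply: eq_bigr => b _; rewrite scaler_sumr -big_split; apply: eq_bigr => i _.
by rewrite !ffunE lf scalerDr !scalerA mulrC.
Qed.

Lemma ampZ k p m (U W : lmodType C) (A : 'I_k -> 'M[C]_(p, m))
    (f : 'I_k -> U -> W) a x : (forall i, linear (f i)) ->
    amp A f (a *: x) = a *: amp A f x.
Proof.
move=> /(amp_linear A) h; have h0 : amp A f 0 = 0.
  by apply: (addrI (amp A f 0)); rewrite -{2}[amp A f 0]scale1r addrC -h scale1r !addr0.
by rewrite -[a *: x]addr0 h h0 addr0.
Qed.

Lemma scal_adj p m (U : lmodType C) (d : {dot U for Num.conj})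
   (A : 'M[C]_(p, m)) x y :
  dot_pow d (scal A x) y = dot_pow d x (scal A^H y).
Proof.
rewrite /dot_pow.
transitivity (\sum_a \sum_b A a b * d (x b) (y a)).
  apply: eq_bigr => a _; rewrite ffunE dot_suml; apply: eq_bigr => b _.
  by rewrite dotZl.
rewrite exchange_big; apply: eq_bigr => b _.
rewrite ffunE dot_sumr; apply: eq_bigr => a _.
by rewrite dotZr !mxE conjCK.
Qed.

Lemma scalM p q m (U : lmodType C) (A : 'M[C]_(p, q)) (B : 'M[C]_(q, m))
   (x : {ffun 'I_m -> U}) : scal (A *m B) x = scal A (scal B x).
Proof.
apply/ffunP => a; rewrite !ffunE.
under [RHS]eq_bigr do rewrite ffunE scaler_sumr.
rewrite exchange_big; apply: eq_bigr => b _.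
by rewrite mxE scaler_suml; apply: eq_bigr => c _; rewrite scalerA.
Qed.

Lemma scal1 m (U : lmodType C) (x : {ffun 'I_m -> U}) : scal 1%:M x = x.
Proof.
apply/ffunP => a; rewrite ffunE (bigD1 a) //= mxE eqxx scale1r big1 ?addr0 //.
by move=> b /negPf; rewrite eq_sym mxE => ->; rewrite scale0r.
Qed.

(** With D = E^H this makes positivity invariant under congruence. *)
Lemma amp_scal k p q m n (U W : lmodType C) (f : 'I_k -> U -> W)
  (D : 'M[C]_(p, q)) (A : 'I_k -> 'M[C]_(q, m)) (E : 'M[C]_(m, n)) x :
  (forall i, linear (f i)) ->
  amp (fun i => D *m A i *m E) f x = scal D (amp A f (scal E x)).
Proof.
move=> lf; have lf_sum i (I : finType) (c : I -> C) (z : I -> U) :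
    f i (\sum_j c j *: z j) = \sum_j c j *: f i (z j).
  pose h : {linear U -> W} := HB.pack (f i)
    (GRing.isLinear.Build _ _ _ _ (f i) (lf i)).
  rewrite -[f i]/(h : U -> W) linear_sum.
  by apply: eq_bigr => j _; rewrite linearZ.
apply/ffunP => a; rewrite !ffunE.
transitivity (\sum_b \sum_i \sum_c \sum_e
   (D a e * A i e c * E c b) *: f i (x b)).
  apply: eq_bigr => b _; apply: eq_bigr => i _.
  rewrite mxE scaler_suml; apply: eq_bigr => c _.
  by rewrite mxE mulr_suml scaler_suml; apply: eq_bigr => e _.
transitivity (\sum_e \sum_c \sum_i \sum_b
   (D a e * A i e c * E c b) *: f i (x b)).
  transitivity (\sum_b \sum_e \sum_c \sum_i
      (D a e * A i e c * E c b) *: f i (x b)).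
    apply: eq_bigr => b _; rewrite exchange_big /= [RHS]exchange_big.
    by apply: eq_bigr => c _; rewrite exchange_big.
  rewrite exchange_big; apply: eq_bigr => e _; rewrite exchange_big.
  by apply: eq_bigr => c _; rewrite exchange_big.
apply: eq_bigr => e _; rewrite ffunE scaler_sumr; apply: eq_bigr => c _.
rewrite scaler_sumr; apply: eq_bigr => i _.
rewrite ffunE lf_sum !scaler_sumr; apply: eq_bigr => b _.
by rewrite !scalerA.
Qed.
End Amp.

Section AmpMore.
Variable R : realType.
Local Notation K := R[i].

Lemma scalDl p m (U : lmodType K) (A B : 'M[K]_(p, m)) (x : {ffun 'I_m -> U}) :
  scal (A + B) x = scal A x + scal B x.
Proof.
apply/ffunP => a; rewrite !ffunE -big_split.
by apply: eq_bigr => b _; rewrite mxE scalerDl.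
Qed.

Lemma scal_scalar m (U : lmodType K) c (x : {ffun 'I_m -> U}) :
  scal c%:M x = c *: x.
Proof.
apply/ffunP => a; rewrite !ffunE (bigD1 a) //= mxE eqxx big1 ?addr0 //.
by move=> b /negPf; rewrite eq_sym mxE => ->; rewrite scale0r.
Qed.

Lemma ampDl k p m (U W : lmodType K) (A B : 'I_k -> 'M[K]_(p, m))
    (f : 'I_k -> U -> W) x :
  amp (fun i => A i + B i) f x = amp A f x + amp B f x.
Proof.
apply/ffunP => a; rewrite !ffunE -big_split; apply: eq_bigr => b _.
by rewrite -big_split; apply: eq_bigr => i _; rewrite mxE scalerDl.
Qed.

Lemma ampZl k p m (U W : lmodType K) c (A : 'I_k -> 'M[K]_(p, m))
    (f : 'I_k -> U -> W) x :
  amp (fun i => c *: A i) f x = c *: amp A f x.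
Proof.
apply/ffunP => a; rewrite !ffunE scaler_sumr; apply: eq_bigr => b _.
by rewrite scaler_sumr; apply: eq_bigr => i _; rewrite mxE scalerA.
Qed.

Lemma eq_amp k p m (U W : lmodType K) (A B : 'I_k -> 'M[K]_(p, m))
    (f : 'I_k -> U -> W) : A =1 B -> amp A f = amp B f.
Proof. by move=> /funext ->. Qed.

End AmpMore.

Section PairedFamilies.
Variable R : realType.
Local Notation K := R[i].

(** The identification of U^m x W^m with (U x W)^m: operators on (H x H)^m are
    then 2 x 2 blocks of operators on H^m. *)
Definition pairff m (U W : lmodType K) (u : {ffun 'I_m -> U})
  (w : {ffun 'I_m -> W}) : {ffun 'I_m -> U * W} := [ffun a => (u a, w a)].
Lemma pairff_eta m (U W : lmodType K) (x : {ffun 'I_m -> U * W}) :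
  x = pairff [ffun a => (x a).1] [ffun a => (x a).2].
Proof. by apply/ffunP => a; rewrite !ffunE; case: (x a). Qed.
Lemma dot_pairff m (U : lmodType K) (d : {dot U for Num.conj})
    (u v u' v' : {ffun 'I_m -> U}) :
  dot_pow (dot_sum d d) (pairff u v) (pairff u' v') =
  dot_pow d u u' + dot_pow d v v'.
Proof.
by rewrite /dot_pow -big_split; apply: eq_bigr => a _; rewrite !ffunE.
Qed.
Lemma sqnorm_pairff m (U : lmodType K) (d : {dot U for Num.conj})
    (u v : {ffun 'I_m -> U}) :
  sqnorm (dpw (dot_sum d d)) (pairff u v) =
  sqnorm (dpw d) u + sqnorm (dpw d) v.
Proof. by rewrite -[LHS]/(Re (dot_pow _ _ _)) dot_pairff cReD. Qed.

End PairedFamilies.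

Section ConsFamilies.
Variable R : realType.
Local Notation K := R[i].

(** Index 0 is the coefficient of the unit H_0; the others are those of the
    off-diagonal H_i. *)
Definition fcons (T : Type) n (t : T) (s : 'I_n -> T) (i : 'I_n.+1) : T :=
  if unlift ord0 i is Some j then s j else t.
Lemma fcons0 T n (t : T) (s : 'I_n -> T) : fcons t s ord0 = t.
Proof. by rewrite /fcons unlift_none. Qed.
Lemma fconsS T n (t : T) (s : 'I_n -> T) j : fcons t s (lift ord0 j) = s j.
Proof. by rewrite /fcons liftK. Qed.
Lemma fcons_eta T n (s : 'I_n.+1 -> T) : s =1 fcons (s ord0) (s \o lift ord0).
Proof. by move=> i; rewrite /fcons; case: unliftP => [j|] ->. Qed.

Lemma Psi_fcons n m k p q A0 (A : 'I_n -> 'M[K]_(m, k)) B0 (B : 'I_n -> 'M[K]_(p, q))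
   (X : 'M[K]_(k, q)) :
  Psi (fcons A0 A) (fcons B0 B) X = A0 *m X *m B0^T + Psi A B X.
Proof.
rewrite /Psi big_ord_recl !fcons0; congr (_ + _); apply: eq_bigr => i _.
by rewrite !fconsS.
Qed.

Lemma eq_Psi n m k p q (A A' : 'I_n -> 'M[K]_(m, k)) (B B' : 'I_n -> 'M[K]_(p, q)) :
  A =1 A' -> B =1 B' -> Psi A B = Psi A' B'.
Proof. by move=> /funext -> /funext ->. Qed.

(** Congruence of both families is the substitution of E X F^T for X in the
    form. *)
Lemma Psi_congr n m k r s (A : 'I_n -> 'M[K]_m) (B : 'I_n -> 'M[K]_k)
   (E : 'M[K]_(m, r)) (F : 'M[K]_(k, s)) X :
  dot_mx (Psi (fun i => E^H *m A i *m E) (fun i => F^H *m B i *m F) X) X =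
  dot_mx (Psi A B (E *m X *m F^T)) (E *m X *m F^T).
Proof.
transitivity (dot_mx (E^H *m Psi A B (E *m X *m F^T) *m (F^H)^T) X).
  congr (dot_mx _ X); rewrite /Psi mulmx_sumr mulmx_suml; apply: eq_bigr => i _.
  by rewrite !trmx_mul !mulmxA.
rewrite -mulmxA dot_mx_mull adjK dot_mx_mulr.
congr (dot_mx _ (_ *m _)).
by apply/matrixP => i j; rewrite !mxE conjCK.
Qed.

Lemma Psi_herm n m k (A : 'I_n -> 'M[K]_m) (B : 'I_n -> 'M[K]_k) X Y :
  dot_mx (Psi A B X) Y = dot_mx X (Psi (fun i => (A i)^H) (fun i => (B i)^H) Y).
Proof.
rewrite /Psi dot_suml dot_sumr; apply: eq_bigr => i _.
rewrite -[LHS]/(dot_mx _ _) -[RHS]/(dot_mx _ _) -mulmxA dot_mx_mull dot_mx_mulr.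
congr (dot_mx _ (_ *m _)).
by apply/matrixP => a b; rewrite !mxE.
Qed.

End ConsFamilies.

Section DotPowTheory.
Variables (R : realType) (m : nat) (U : lmodType R[i]).
Variable d : {dot U for Num.conj}.
Implicit Types x y z : {ffun 'I_m -> U}.
Lemma dot_powDl x y z : dot_pow d (x + y) z = dot_pow d x z + dot_pow d y z.
Proof. exact: (dotDl (dpw d)). Qed.
Lemma dot_powZl a x z : dot_pow d (a *: x) z = a * dot_pow d x z.
Proof. exact: (dotZl (dpw d)). Qed.
Lemma dot_pow0r z : dot_pow d z 0 = 0.
Proof. exact: (dot0r (dpw d)). Qed.
Lemma dot_powC x y : dot_pow d x y = Num.conj (dot_pow d y x).
Proof. exact: (dotC (dpw d)). Qed.
Lemma dot_powxx x : dot_pow d x x = (sqnorm (dpw d) x)%:C.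
Proof. exact: (dotxx (dpw d)). Qed.
End DotPowTheory.

Section CatFF.
Variable R : realType.
Local Notation K := R[i].

(** The identification of U^m1 x U^m2 with U^(m1 + m2), which matches
    [block_mx]. *)
Definition catff m1 m2 (U : Type) (x : {ffun 'I_m1 -> U}) (y : {ffun 'I_m2 -> U}) :
  {ffun 'I_(m1 + m2) -> U} :=
  [ffun a : 'I_(m1 + m2) => match fintype.split a with inl i => x i | inr j => y j end].
Lemma catff_l m1 m2 (U : Type) (x : {ffun 'I_m1 -> U}) (y : {ffun 'I_m2 -> U}) i :
  catff x y (lshift m2 i) = x i.
Proof. by rewrite ffunE (unsplitK (inl i)). Qed.
Lemma catff_r m1 m2 (U : Type) (x : {ffun 'I_m1 -> U}) (y : {ffun 'I_m2 -> U}) j :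
  catff x y (rshift m1 j) = y j.
Proof. by rewrite ffunE (unsplitK (inr j)). Qed.
Lemma catff_eta m1 m2 (U : Type) (x : {ffun 'I_(m1 + m2) -> U}) :
  x = catff [ffun i => x (lshift m2 i)] [ffun j => x (rshift m1 j)].
Proof.
by apply/ffunP => a; rewrite ffunE; case: split_ordP => j ->; rewrite ffunE.
Qed.
Lemma dot_catff m1 m2 (U : lmodType K) (d : {dot U for Num.conj})
   (x x' : {ffun 'I_m1 -> U}) (y y' : {ffun 'I_m2 -> U}) :
  dot_pow d (catff x y) (catff x' y') = dot_pow d x x' + dot_pow d y y'.
Proof.
rewrite /dot_pow big_split_ord; congr (_ + _); apply: eq_bigr => i _.
  by rewrite !catff_l.
by rewrite !catff_r.
Qed.
Lemma amp_block k p1 p2 m1 m2 (U W : lmodType K) (f : 'I_k -> U -> W)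
   (A : 'I_k -> 'M[K]_(p1, m1)) (B : 'I_k -> 'M[K]_(p1, m2))
   (C : 'I_k -> 'M[K]_(p2, m1)) (D : 'I_k -> 'M[K]_(p2, m2)) x y :
  amp (fun i => block_mx (A i) (B i) (C i) (D i)) f (catff x y) =
  catff (amp A f x + amp B f y) (amp C f x + amp D f y).
Proof.
rewrite [LHS]catff_eta; congr catff; apply/ffunP => a; rewrite !ffunE big_split_ord.
  congr (_ + _); apply: eq_bigr => b _; apply: eq_bigr => i _.
    by rewrite block_mxEul catff_l.
  by rewrite block_mxEur catff_r.
congr (_ + _); apply: eq_bigr => b _; apply: eq_bigr => i _.
  by rewrite block_mxEdl catff_l.
by rewrite block_mxEdr catff_r.
Qed.
End CatFF.

(** * Spectral factorisations *)

Section Spectral.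
Variable R : realType.
Local Notation K := R[i].

Lemma hermitian_diag m (A : 'M[K]_m) : A^H = A ->
  exists (P : 'M[K]_m) (l : 'I_m -> R),
  [/\ P *m P^H = 1%:M, P^H *m P = 1%:M &
      A = P^H *m diag_mx (\row_j (l j)%:C) *m P].
Proof.
move=> hA.
have hherm : A \is hermsymmx.
  by apply/is_hermitianmxP; rewrite expr0 scale1r; exact: esym.
have := orthomx_spectralP (hermitian_normalmx hherm).
have /mxOverP := hermitian_spectral_diag_real hherm.
have /unitarymxP := spectral_unitarymx A.
have := invmx_unitary (spectral_unitarymx A).
set P := spectralmx A; set D := spectral_diag A => -> PP Dre AE.
exists P, (fun j => Re (D 0 j)); split.
- exact: PP.
- exact: mulmx1C PP.
- have <- : D = \row_j (Re (D 0 j))%:C by apply/rowP => j; rewrite mxE RRe_real.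
  exact: AE.
Qed.

Definition psd m (A : 'M[K]_m) := forall x : 'cV[K]_m, 0 <= dot_mx (A *m x) x.

(** E is the square root of A + eps in an eigenbasis of A; for positive eps its
    eigenvalues do not vanish. *)
Lemma pd_factor m (A : 'M[K]_m) (eps : R) : A^H = A -> psd A -> 0 <= eps ->
  exists E : 'M[K]_m, A + (eps%:C)%:M = E^H *m E /\ (0 < eps -> E \in unitmx).
Proof.
move=> hA psdA e0; have [P [l [PP PP' AE]]] := hermitian_diag hA.
have l0 j : 0 <= l j.
  have := psdA (P^H *m delta_mx j 0).
  rewrite AE -!mulmxA (mulmxA P) PP mul1mx dot_mx_mull adjK mulmxA PP mul1mx.
  rewrite dot_mxE (bigD1 j) //= big_ord1 big1 ?addr0; last first.
    move=> i ij; rewrite big_ord1 [delta_mx j 0 i _]mxE (negPf ij) /=.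
    by rewrite conjC0 mulr0.
  by rewrite mul_diag_mx !mxE !eqxx mulr1 conjC1 mulr1 ler0c.
exists (diag_mx (\row_j (Num.sqrt (l j + eps))%:C) *m P); split.
  rewrite adjM !mulmxA -[in RHS](mulmxA P^H).
  rewrite tr_diag_mx map_diag_mx mulmx_diag.
  rewrite (_ : (eps%:C)%:M = P^H *m (eps%:C)%:M *m P); last first.
    by rewrite mul_mx_scalar -scalemxAl PP' scalemx1.
  rewrite {1}AE -mulmxDl -mulmxDr -diag_const_mx -linearD /=.
  set u := _ + _; set v := \row_j _; suff -> : u = v by [].
  apply/rowP => j; rewrite !mxE.
  rewrite conj_realC -rmorphM -rmorphD /= -expr2 sqr_sqrtr //.
  by rewrite addr_ge0.
move=> ep; rewrite unitmx_mul; apply/andP; split.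
  rewrite unitmxE det_diag unitfE; apply/prodf_neq0 => j _.
  rewrite mxE eq_complex /= eqxx andbT gt_eqF // sqrtr_gt0.
  by rewrite ltr_wpDl.
by have [] := mulmx1_unit PP.
Qed.

(** Cauchy-Schwarz for the rows of A and the columns of B. *)
Lemma sqnorm_mulmx m n p (A : 'M[K]_(m, n)) (B : 'M[K]_(n, p)) :
  sqnorm dot_mx (A *m B) <= sqnorm dot_mx A * sqnorm dot_mx B.
Proof.
have sqnormE q r (X : 'M[K]_(q, r)) :
    (sqnorm dot_mx X)%:C = \sum_i \sum_j `|X i j| ^+ 2.
  rewrite -dotxx [LHS]dot_mxE; apply: eq_bigr => i _; apply: eq_bigr => j _.
  by rewrite normCK.
rewrite -lecR rmorphM /= !sqnormE [X in _ <= _ * X]exchange_big /=.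
rewrite mulr_suml; apply: ler_sum => i _; rewrite mulr_sumr; apply: ler_sum => j _.
have -> : (A *m B) i j = dot_mx (row i A) (col j B)^H.
  rewrite dot_mxE big_ord1 mxE; apply: eq_bigr => k _.
  by rewrite !mxE conjCK.
have h : `|dot_mx (row i A) (col j B)^H| ^+ 2 <=
    dot_mx (row i A) (row i A) * dot_mx (col j B)^H (col j B)^H.
  by have [] := @CauchySchwarz _ _ dot_mx (row i A) (col j B)^H.
apply: le_trans h _.
have -> : dot_mx (row i A) (row i A) = \sum_i0 `|A i i0| ^+ 2.
  by rewrite dot_mxE big_ord1; apply: eq_bigr => k _; rewrite mxE normCK.
have -> : dot_mx (col j B)^H (col j B)^H = \sum_i0 `|B i0 j| ^+ 2.
  by rewrite dot_mxE big_ord1; apply: eq_bigr => k _; rewrite !mxE conjCK normCK mulrC.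
by [].
Qed.

Lemma sqnorm_block m1 m2 n1 n2 (A : 'M[K]_(m1, n1)) (B : 'M[K]_(m1, n2))
  (D : 'M[K]_(m2, n1)) (E : 'M[K]_(m2, n2)) :
  sqnorm dot_mx (block_mx A B D E) =
  sqnorm dot_mx A + sqnorm dot_mx B + sqnorm dot_mx D + sqnorm dot_mx E.
Proof.
rewrite -[LHS]/(Re (\tr (_ *m _))) tr_block_mx map_block_mx mulmx_block.
by rewrite mxtrace_block !mxtraceD !cReD addrA.
Qed.

(** A form of the polar decomposition.  Let Z be the hermitian matrix
    [[0, X], [X^H, 0]] = P^H L P, where P = [P1 P2] and L is real diagonal, so that
    X = P1^H L P2.  Writing L = |L|^(1/2) . sgn L |L|^(1/2) splits X into C D^H,
    and C C^H, D D^H are the diagonal blocks of |Z| = P^H |L| P, whose norm is that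
    of Z.  Only the sum of their squared norms is controlled, which is enough when
    C and D enter through an arithmetic mean. *)
Lemma polar_factor m n (X : 'M[K]_(m, n)) :
  exists r (C : 'M[K]_(m, r)) (D : 'M[K]_(n, r)),
  X = C *m D^H /\
  sqnorm dot_mx (C *m C^H) + sqnorm dot_mx (D *m D^H) <= 2 * sqnorm dot_mx X.
Proof.
pose Z : 'M[K]_(m + n) := block_mx 0 X X^H 0.
have hZ : Z^H = Z.
  by rewrite tr_block_mx map_block_mx !trmx0 !map_mx0 adjK.
have [P [l [PP PP' ZE]]] := hermitian_diag hZ.
pose P1 := lsubmx P; pose P2 := rsubmx P.
have PE : P = row_mx P1 P2 by rewrite hsubmxK.
have PHE : P^H = col_mx P1^H P2^H by rewrite PE tr_row_mx map_col_mx.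
pose sq := diag_mx (\row_j (Num.sqrt `|l j|)%:C).
pose sg := diag_mx (\row_j (Num.sg (l j))%:C).
pose ab := diag_mx (\row_j `|l j|%:C).
have diagH (u : 'I_(m + n) -> R) :
    (diag_mx (\row_j (u j)%:C))^H = diag_mx (\row_j (u j)%:C).
  rewrite tr_diag_mx map_diag_mx; congr diag_mx; apply/rowP => j.
  by rewrite !mxE; exact: conj_realC.
have sqH : sq^H = sq by exact: diagH.
have sgH : sg^H = sg by exact: diagH.
have sqsq : sq *m sq = ab.
  rewrite mulmx_diag; congr diag_mx; apply/rowP => j.
  by rewrite !mxE -rmorphM /= -expr2 sqr_sqrtr.
have ZE2 : sq *m sq *m sg = diag_mx (\row_j (l j)%:C).
  rewrite sqsq mulmx_diag; congr diag_mx; apply/rowP => j.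
  by rewrite !mxE -rmorphM /= mulrC -numEsg.
have XE : X = P1^H *m diag_mx (\row_j (l j)%:C) *m P2.
  have : Z = col_mx (P1^H *m diag_mx (\row_j (l j)%:C))
                    (P2^H *m diag_mx (\row_j (l j)%:C)) *m row_mx P1 P2.
    by rewrite {1}ZE PHE {1}PE !mul_col_mx.
  by rewrite mul_col_row => /eq_block_mx[].
exists (m + n)%N, (P1^H *m sq), (P2^H *m (sg *m sq)); split.
  rewrite [(P2^H *m _)^H]adjM [(sg *m sq)^H]adjM adjK sqH sgH XE -ZE2.
  by clearbody sq sg P1 P2; rewrite !mulmxA.
have -> : P1^H *m sq *m (P1^H *m sq)^H = P1^H *m ab *m P1.
  by rewrite adjM adjK sqH -sqsq !mulmxA.
have -> : P2^H *m (sg *m sq) *m (P2^H *m (sg *m sq))^H = P2^H *m ab *m P2.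
  have <- : sg *m sq *m (sg *m sq)^H = ab.
    rewrite adjM sqH sgH !mulmxA -(mulmxA sg) sqsq !mulmx_diag.
    congr diag_mx; apply/rowP => j; rewrite !mxE -!rmorphM /=.
    by rewrite -numEsg mulrC -normrEsg.
  by rewrite [(P2^H *m _)^H]adjM adjK !mulmxA.
have <- : sqnorm dot_mx Z = 2 * sqnorm dot_mx X.
  by rewrite sqnorm_block sqnorm_adj !sqnorm0; ring.
have -> : sqnorm dot_mx Z = sqnorm dot_mx (P^H *m ab *m P).
  have inv (M : 'M[K]_(m + n)) : sqnorm dot_mx (P^H *m M *m P) = sqnorm dot_mx M.
    rewrite -[LHS]/(Re (dot_mx _ _)) -mulmxA dot_mx_mull adjK !mulmxA PP mul1mx.
    by rewrite dot_mx_mulr -mulmxA PP mulmx1.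
  rewrite inv ZE inv -[LHS]/(Re (\tr (_ *m _))) -[RHS]/(Re (\tr (_ *m _))).
  rewrite !diagH !mulmx_diag; congr (Re (\tr (diag_mx _))); apply/rowP => j.
  by rewrite !mxE -!rmorphM /= -!expr2 real_normK ?num_real.
rewrite PHE PE mul_col_mx mul_col_row sqnorm_block.
have := sqnorm_ge0 dot_mx (P1^H *m ab *m P2).
have := sqnorm_ge0 dot_mx (P2^H *m ab *m P1).
lra.
Qed.
Lemma psd_herm m (M : 'M[K]_m) : psd M -> M^H = M.
Proof.
move=> pM; have lM : linear (mulmx M : 'cV_m -> 'cV_m).
  by move=> a x y; rewrite mulmxDr scalemxAr.
have hM (x y : 'cV_m) : dot_mx (M *m x) y = dot_mx x (M *m y).
  exact: (@herm_of_pos _ _ (@dot_mx R m 1) _ lM pM).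
have h (x : 'cV[K]_m) : M^H *m x = M *m x.
  apply: (dot_inj (d := @dot_mx R m 1)) => y; rewrite -[RHS]hM.
  by rewrite -[LHS]/(dot_mx y (M^H *m x)) dot_mx_mull.
apply/matrixP => i j; have /matrixP/(_ i ord0) := h (delta_mx j ord0).
by rewrite -!colE !mxE.
Qed.

(** The norm of A ⊗ 1 on V^m is that of A, for V of any dimension: with
    c - A^H A = E^H E, the difference c |x|^2 - |A x|^2 is |E x|^2. *)
Lemma scal_sqbound (V : lmodType K) (dV : {dot V for Num.conj}) m (A : 'M[K]_m) (c : R) :
  (forall x : 'cV[K]_m, sqnorm dot_mx (A *m x) <= c * sqnorm dot_mx x) ->
  sqbound (dpw dV) (scal A) c.
Proof.
move=> hA x.
pose M := (c%:C)%:M - A^H *m A.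
have hM : M^H = M.
  rewrite /M linearB /= map_mxB adjM adjK tr_scalar_mx map_scalar_mx.
  by congr (_%:M - _); exact: conj_realC.
have pM : psd M.
  move=> y; rewrite mulmxBl mul_scalar_mx.
  have -> : dot_mx (c%:C *: y - A^H *m A *m y) y =
      (c * sqnorm dot_mx y - sqnorm dot_mx (A *m y))%:C.
    rewrite dot_mxDl dot_mxZl dot_mxNl -mulmxA (dot_mx_mull A^H) adjK !dot_mxxx.
    by rewrite rmorphB rmorphM.
  by rewrite ler0c subr_ge0.
have [E [hE _]] := pd_factor hM pM (lexx 0).
have := congr1 (fun B => dot_pow dV (scal (B + A^H *m A) x) x) hE.
rewrite raddf0 addr0 subrK scal_scalar dot_powZl scalDl dot_powDl !scalM.
rewrite (scal_adj dV E^H) (scal_adj dV A^H) !adjK !dot_powxx.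
rewrite -rmorphM -rmorphD => /complexI ->.
by rewrite lerDr sqnorm_ge0.
Qed.

End Spectral.

(** * Norms of the superoperators of matrix families, and Haagerup's inequality *)

Section MatrixIneq.
Variable R : realType.
Local Notation K := R[i].

Lemma sqnorm_col m (x : 'cV[K]_m) : sqnorm (@dot_col R m) x = sqnorm dot_mx x.
Proof.
rewrite -[RHS]/(Re (dot_mx _ _)) dot_mxE -[LHS]/(Re (dot_col _ _)); congr Re.
by apply: eq_bigr => i _; rewrite big_ord1.
Qed.

Lemma sqnorm_vec m n (X : 'M[K]_(m, n)) : sqnorm (@dot_col R _) (vec X) = sqnorm dot_mx X.
Proof. by rewrite -[LHS]/(Re (dot_col _ _)) dot_col_vec. Qed.

Lemma sqbound_Phi k m (A : 'I_k -> 'M[K]_m) c :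
  sqbound (@dot_col R _) (mulmx (\sum_i A i *t map_mx Num.conj (A i))) c <->
  sqbound dot_mx (Phi A) c.
Proof.
split=> h X.
  by rewrite -!sqnorm_vec -Phi_vec; exact: h.
by rewrite -[X](@unvecK R m m) Phi_vec !sqnorm_vec; exact: h.
Qed.

Lemma op_norm_mulmx_leE m (M : 'M[K]_m) (c : R) : 0 <= c ->
  (op_norm (@dot_col R m) (mulmx M) <= c%:E)%E <->
  sqbound (@dot_col R m) (mulmx M) (c ^+ 2).
Proof. by move=> c0; apply: op_norm_leE => // a x; rewrite scalemxAr. Qed.

(** The operator norm is at most the Hilbert-Schmidt norm. *)
Lemma op_norm_mulmx_fin m (M : 'M[K]_m) :
  exists2 c : R, 0 <= c & op_norm (@dot_col R m) (mulmx M) = c%:E.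
Proof.
have h : (op_norm (@dot_col R m) (mulmx M) <= (Num.sqrt (sqnorm dot_mx M))%:E)%E.
  apply/(op_norm_mulmx_leE _ (sqrtr_ge0 _)) => x.
  by rewrite sqr_sqrtr ?sqnorm_ge0 // !sqnorm_col sqnorm_mulmx.
have := op_norm_ge0 (@dot_col R m) (mulmx M).
case: (op_norm _ _) h => [c _| |] //; rewrite ?lee_fin.
by move=> c0; exists c.
Qed.

(** The exact norm r^2 of [Phi A] is needed: later arguments turn the bound r^2
    into a bound linear in r, and compare the two. *)
Lemma Phi_norm k m (A : 'I_k -> 'M[K]_m) : exists r : R,
  [/\ 0 <= r, sqbound dot_mx (Phi A) (r ^+ 4) &
     forall s, 0 <= s -> sqbound dot_mx (Phi A) (s ^+ 2) -> r ^+ 2 <= s].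
Proof.
have [c c0 cE] := op_norm_mulmx_fin (\sum_i A i *t map_mx Num.conj (A i)).
exists (Num.sqrt c); split; first exact: sqrtr_ge0.
  rewrite (exprM _ 2 2) sqr_sqrtr //; apply/sqbound_Phi/op_norm_mulmx_leE => //.
  by rewrite cE.
move=> s s0 /sqbound_Phi/(op_norm_mulmx_leE _ s0); rewrite cE sqr_sqrtr //.
Qed.

Lemma mxop_tens_sum (U : lmodType K) k m (A : 'I_k -> 'M[K]_m) (e : 'I_k -> U -> U) :
  mxop (tens_sum A e) = amp A e.
Proof.
apply/funext => x; apply/ffunP => a; rewrite !ffunE; apply: eq_bigr => b _.
by rewrite mxE fct_sumE.
Qed.
End MatrixIneq.

Section Haagerup.
Variable R : realType.
Local Notation K := R[i].

Lemma sum_sqnorm_Phi k m r (A : 'I_k -> 'M[K]_m) (C : 'M[K]_(m, r)) :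
  \sum_i sqnorm dot_mx (C^H *m A i *m C) =
  redot dot_mx (Phi A (C *m C^H)) (C *m C^H).
Proof.
rewrite /redot /Phi dot_suml cRe_sum.
apply: eq_bigr => i _; congr Re; rewrite -[LHS]/(dot_mx _ _).
set X := A i *m _ *m _; transitivity (dot_mx (C^H *m X) C^H).
  rewrite (_ : C^H *m X = (C^H *m A i *m C) *m (C^H *m (A i)^H)).
    by rewrite [RHS]dot_mx_mulr adjM !adjK !mulmxA.
  by rewrite /X !mulmxA.
by rewrite dot_mx_mull adjK.
Qed.

(** Let X = C D^H as in [polar_factor].  Then <A_i X B_i^T, X> is the inner
    product of C^H A_i C and conj (D'^H B_i D') with D' = conj D, so its absolute
    value is at most the mean of their squared norms.  Summed over i, these are
    <Phi A (C C^H), C C^H> <= |C C^H|^2 and the analogue for B and D', and the two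
    bounds add up to at most 2 |X|^2. *)
Lemma haagerup k m n (A : 'I_k -> 'M[K]_m) (B : 'I_k -> 'M[K]_n) :
  (forall i, (A i)^H = A i) -> (forall i, (B i)^H = B i) ->
  sqbound dot_mx (Phi A) 1 -> sqbound dot_mx (Phi B) 1 -> forall X,
  - sqnorm dot_mx X <= redot dot_mx (Psi A B X) X.
Proof.
move=> hA hB bA bB X; have [r [C [D [XE le]]]] := polar_factor X.
pose D' := map_mx Num.conj D.
have contr q (F : 'I_k -> 'M[K]_q) (E : 'M[K]_(q, r)) : sqbound dot_mx (Phi F) 1 ->
   \sum_i sqnorm dot_mx (E^H *m F i *m E) <= sqnorm dot_mx (E *m E^H).
  move=> bF; rewrite sum_sqnorm_Phi.
  exact: mean_bound (bF (E *m E^H)) (redot_le_mean dot_mx _ _).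
have h1 := contr _ _ C bA; have h2 := contr _ _ D' bB.
have e2 : sqnorm dot_mx (D' *m D'^H) = sqnorm dot_mx (D *m D^H).
  by rewrite -[RHS]sqnorm_conjmx map_mxM map_trmx.
rewrite -e2 in le; apply: sum_bound le h1 h2 _.
rewrite /redot /Psi dot_suml cRe_sum.
rewrite -big_split -sumrN mulr_sumr; apply: ler_sum => i _ /=.
have E : dot_mx (A i *m X *m (B i)^T) X =
    dot_mx (C^H *m A i *m C) (map_mx Num.conj (D'^H *m B i *m D')).
  transitivity (dot_mx (C^H *m (A i *m X *m (B i)^T)) D^H).
    by rewrite [RHS]dot_mx_mull adjK -XE.
  have -> : map_mx Num.conj (D'^H *m B i *m D') = D^H *m ((B i)^T)^H *m D.
    have D'H : D'^H = D^T by apply/matrixP => p q; rewrite !mxE conjCK.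
    by rewrite D'H !map_mxM /D' conj_mxK trmxK.
  have -> : C^H *m (A i *m X *m (B i)^T) = (C^H *m A i *m C) *m (D^H *m (B i)^T).
    by rewrite XE !mulmxA.
  by rewrite dot_mx_mulr adjM adjK mulmxA.
rewrite E -[X in - (_ + X)]sqnorm_conjmx.
have := redot_le_mean dot_mx (- (C^H *m A i *m C)) (map_mx Num.conj (D'^H *m B i *m D')).
by rewrite redotNl sqnormN; exact: opp_bound.
Qed.
End Haagerup.

Section PhiMore.
Variable R : realType.
Local Notation K := R[i].
Variables (k m : nat) (A : 'I_k -> 'M[K]_m).

Lemma Phi_conj X : Phi (fun i => map_mx Num.conj (A i)) X =
  map_mx Num.conj (Phi A (map_mx Num.conj X)).
Proof.
rewrite /Phi map_mx_sum; apply: eq_bigr => i _.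
by rewrite !map_mxM conj_mxK map_trmx.
Qed.

Lemma sqbound_Phi_conj c : sqbound dot_mx (Phi A) c ->
  sqbound dot_mx (Phi (fun i => map_mx Num.conj (A i))) c.
Proof. by move=> h X; rewrite Phi_conj sqnorm_conjmx -(sqnorm_conjmx X); exact: h. Qed.

Lemma Phi_scale (s : R) X : Phi (fun i => s%:C *: A i) X =
  (s ^+ 2)%:C *: Phi A X.
Proof.
rewrite /Phi scaler_sumr; apply: eq_bigr => i _.
by rewrite adjZ conj_realC -!scalemxAl -scalemxAr scalerA -rmorphM expr2.
Qed.

Lemma sqbound_Phi_scale (s : R) c : sqbound dot_mx (Phi A) c ->
  sqbound dot_mx (Phi (fun i => s%:C *: A i)) (s ^+ 4 * c).
Proof.
move=> h X; rewrite Phi_scale sqnormZ -exprM -mulrA ler_wpM2l ?h //.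
by rewrite (exprM s 2 2) sqr_ge0.
Qed.

Lemma sqbound_Phi_adj c : 0 <= c -> sqbound dot_mx (Phi A) c ->
  sqbound dot_mx (Phi (fun i => (A i)^H)) c.
Proof.
move=> c0; apply: sqbound_adjoint => // X Y; rewrite /redot; congr Re.
rewrite /Phi dot_suml dot_sumr; apply: eq_bigr => i _.
rewrite -[LHS]/(dot_mx _ _) -[RHS]/(dot_mx _ _) adjK -mulmxA dot_mx_mull.
by rewrite dot_mx_mulr adjK.
Qed.

Lemma Psi_conj X : Psi A (fun i => map_mx Num.conj (A i)) X = Phi A X.
Proof. by apply: eq_bigr => i _; rewrite map_trmx. Qed.
End PhiMore.

(** * Positivity over SOH(n) *)

Section SOH.
Variables (R : realType) (H : lmodType R[i]) (d : {dot H for Num.conj}).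
Variables (n : nat) (e : 'I_n -> H -> H).
Hypothesis lin_e : forall i, linear (e i).
Hypothesis e_adj : forall i x y, d (e i x) y = d x (adjoint d (e i) y).
Hypothesis OH : OH_basis d e.
Hypothesis n_gt0 : (0 < n)%N.
Local Notation K := R[i].
Local Notation e' := (fun i => adjoint d (e i)).
Local Notation ds := (dot_sum d d).
Local Notation op := (SOH_op d e).
Local Notation S := (SOH d e).
Local Notation gen := (SOH_gen d e).

(** The norm of OH(n) is the square root of the norm of [Phi A]; this is why the
    exponent doubles. *)
Lemma OH_sqbound m (A : 'I_n -> 'M[R[i]]_m) (c : R) : 0 <= c ->
  sqbound (@dot_pow R _ d m) (amp A e) (c ^+ 2) <-> sqbound dot_mx (Phi A) (c ^+ 4).
Proof.
move=> c0.
transitivity (op_norm (@dot_pow R _ d m) (amp A e) <= c%:E)%E.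
  by apply: iff_sym; apply: op_norm_leE => // a x; exact: ampZ.
rewrite -mxop_tens_sum (OH A) -sqbound_Phi (exprM c 2 2) -op_norm_mulmx_leE ?sqr_ge0 //.
have [s s0 ->] := op_norm_mulmx_fin (\sum_i A i *t map_mx Num.conj (A i)).
rewrite /= !lee_fin -{2}(sqr_sqrtr s0).
by rewrite ler_pXn2r ?nnegrE ?sqrtr_ge0.
Qed.

Definition posS m (A : 'I_n.+1 -> 'M[K]_m) : Prop :=
  forall x, 0 <= dot_pow ds (amp A op x) x.
Definition bndS m (A : 'I_n.+1 -> 'M[K]_m) (c : R) : Prop :=
  sqbound (dpw ds) (amp A op) c.

Lemma e'_adj i x y : d (e' i x) y = d x (e i y).
Proof. by rewrite dotC -e_adj -dotC. Qed.

Lemma lin_e' i : linear (e' i).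
Proof.
move=> a x y; apply: (dot_inj (d := d)) => z.
by rewrite -e_adj dotDr dotZr [RHS]dotDr dotZr -!e_adj.
Qed.

Lemma SOH_op0 : op ord0 = id.
Proof. by rewrite /SOH_op unlift_none. Qed.
Lemma SOH_opS j x : op (lift ord0 j) x = (e j x.2, e' j x.1).
Proof. by rewrite /SOH_op liftK. Qed.

Lemma lin_op i : linear (op i).
Proof.
move=> a x y; rewrite /SOH_op; case: unliftP => [j|] _ //=.
by rewrite lin_e lin_e'.
Qed.

Lemma op_sym i x y : ds (op i x) y = ds x (op i y).
Proof.
rewrite /SOH_op; case: unliftP => [j|] _ //=.
by rewrite /dot_sum /= e_adj e'_adj addrC.
Qed.

Lemma amp_op p m (A : 'I_n.+1 -> 'M[K]_(p, m)) u v :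
  amp A op (pairff u v) =
  pairff (scal (A ord0) u + amp (A \o lift ord0) e v)
         (scal (A ord0) v + amp (A \o lift ord0) e' u).
Proof.
apply/ffunP => a; rewrite !ffunE; under eq_bigr do rewrite big_ord_recl.
have sp (I : finType) (F : I -> H * H) :
   \sum_i F i = (\sum_i (F i).1, \sum_i (F i).2).
  rewrite [LHS]surjective_pairing; congr (_, _).
    exact: (big_morph (@fst H H) (fun x y => erefl _) (erefl _)).
  exact: (big_morph (@snd H H) (fun x y => erefl _) (erefl _)).
rewrite sp; congr (_, _); rewrite -big_split; apply: eq_bigr => b _ /=.
  rewrite SOH_op0 sp !ffunE /=; congr (_ + _); apply: eq_bigr => i _.
  by rewrite SOH_opS.
rewrite SOH_op0 sp !ffunE /=; congr (_ + _); apply: eq_bigr => i _.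
by rewrite SOH_opS.
Qed.

Lemma amp_op_adj p m (A : 'I_n.+1 -> 'M[K]_(p, m)) x y :
  dot_pow ds (amp A op x) y = dot_pow ds x (amp (fun i => (A i)^H) op y).
Proof. by apply: amp_adj; exact: op_sym. Qed.

Lemma amp_e'_adj p m (A : 'I_n -> 'M[K]_(p, m)) x y :
  dot_pow d (amp A e' x) y = dot_pow d x (amp (fun i => (A i)^H) e y).
Proof. by apply: amp_adj; exact: e'_adj. Qed.

(** Σ |A_i|^2 = <Phi A 1, 1>. *)
Lemma Phi_eq0 k m (A : 'I_k -> 'M[K]_m) : sqbound dot_mx (Phi A) 0 -> forall i, A i = 0.
Proof.
move=> h i; have := sum_sqnorm_Phi A (1%:M : 'M[K]_m).
have /eqP : sqnorm dot_mx (Phi A (1%:M *m 1%:M^H)) = 0.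
  by apply: le_anti; rewrite sqnorm_ge0 andbT; have := h (1%:M *m 1%:M^H); rewrite mul0r.
rewrite sqnorm_eq0 => /eqP ->; rewrite /redot dot0l => /eqP.
rewrite psumr_eq0 => [/allP|j _]; last exact: sqnorm_ge0.
move=> /(_ i); rewrite mem_index_enum => /(_ isT) /=.
by rewrite adj1 mul1mx mulmx1 sqnorm_eq0 => /eqP.
Qed.

Lemma amp_e_eq0 m (A : 'I_n -> 'M[K]_m) : (forall v, amp A e v = 0) ->
  forall i, A i = 0.
Proof.
move=> h; apply: Phi_eq0; have := @OH_sqbound _ A 0 (lexx _).
rewrite !expr0n /= => -[+ _]; apply => x.
by rewrite h sqnorm0 mul0r.
Qed.

(** The e_i are nonzero, so H is not the zero space. *)
Lemma unit_vec : exists h : H, sqnorm d h = 1.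
Proof.
have [h h0] : exists h : H, h != 0.
  apply: contrapT => /forallNP nh.
  have h0 (h : H) : h = 0 by apply/eqP/negPn/negP; exact: nh.
  have hv v : amp (fun _ : 'I_n => 1%:M : 'M[K]_1) e v = 0.
    by apply/ffunP => i; rewrite [RHS](h0 _); exact: h0.
  have /matrixP/(_ ord0 ord0)/eqP := amp_e_eq0 hv (Ordinal n_gt0).
  by rewrite !mxE oner_eq0.
have nh : 0 < sqnorm d h by rewrite lt_def sqnorm_ge0 sqnorm_eq0 h0.
exists ((Num.sqrt (sqnorm d h))^-1%:C *: h).
by rewrite sqnormZ exprVn sqr_sqrtr ?ltW // mulVf // gt_eqF.
Qed.

(** On the vectors (0, v), Σ A_i ⊗ H_i shows A_0 ⊗ 1 and Σ A_i ⊗ e_i (i >= 1)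
    separately. *)
Lemma amp_op_inj m (A B : 'I_n.+1 -> 'M[K]_m) :
  (forall x, amp A op x = amp B op x) -> forall i, A i = B i.
Proof.
move=> hAB; pose D i := A i + (-1) *: B i.
have hD x : amp D op x = 0.
  by rewrite ampDl ampZl hAB scaleN1r subrr.
have hD2 v : pairff (amp (D \o lift ord0) e v) (scal (D ord0) v) = pairff 0 0.
  have := hD (pairff 0 v); rewrite amp_op.
  have -> : scal (D ord0) (0 : {ffun _ -> H}) = 0.
    by apply/ffunP => a; rewrite !ffunE big1 // => b _; rewrite ffunE scaler0.
  have -> : amp (D \o lift ord0) e' 0 = 0.
    by rewrite -[0 in LHS](scale0r 0) ampZ ?scale0r //; exact: lin_e'.
  by rewrite add0r addr0 => ->; apply/ffunP => a; rewrite !ffunE.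
suff D0 i : D i = 0.
  by move=> i; have /eqP := D0 i; rewrite /D scaleN1r subr_eq0 => /eqP.
rewrite (fcons_eta D); rewrite /fcons; case: unliftP => [j _|_].
  apply: (@amp_e_eq0 _ (D \o lift ord0)) => v; apply/ffunP => a.
  by have /ffunP/(_ a) := hD2 v; rewrite !ffunE => -[].
have [h nh] := unit_vec.
apply/matrixP => a b.
have /ffunP/(_ a) := hD2 [ffun c => (c == b)%:R *: h]; rewrite !ffunE => -[_].
rewrite (bigD1 b) //= ffunE eqxx scale1r big1 ?addr0; last first.
  by move=> c /negPf cb; rewrite ffunE cb scale0r scaler0.
move=> /eqP; rewrite scaler_eq0 => /orP[/eqP ->|/eqP h0].
  by rewrite mxE.
by move: nh; rewrite h0 sqnorm0 => /esym/eqP; rewrite oner_eq0.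
Qed.

(** The adjoint of Σ A_i ⊗ H_i has the coefficients A_i^H, because the H_i are
    selfadjoint. *)
Lemma posS_herm m (A : 'I_n.+1 -> 'M[K]_m) : posS A -> forall i, (A i)^H = A i.
Proof.
move=> pA i; apply: (@amp_op_inj _ (fun i => (A i)^H)) => {i} x.
apply: (dot_inj (d := dpw ds)) => y.
rewrite -[LHS]amp_op_adj.
apply: herm_of_pos => //; exact/amp_linear/lin_op.
Qed.

Lemma posS_congr m r (A : 'I_n.+1 -> 'M[K]_m) (E : 'M[K]_(m, r)) :
  posS A -> posS (fun i => E^H *m A i *m E).
Proof.
move=> pA x; rewrite amp_scal; last exact: lin_op.
by rewrite scal_adj adjK; exact: pA.
Qed.

Lemma posS_add m (A B : 'I_n.+1 -> 'M[K]_m) : posS A -> posS B ->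
  posS (fun i => A i + B i).
Proof.
move=> pA pB x; rewrite ampDl.
have -> : dot_pow ds (amp A op x + amp B op x) x =
    dot_pow ds (amp A op x) x + dot_pow ds (amp B op x) x.
  exact: dot_powDl.
exact: addr_ge0.
Qed.

Lemma eq_posS m (A B : 'I_n.+1 -> 'M[K]_m) : A =1 B -> posS A -> posS B.
Proof. by move=> /funext ->. Qed.

Lemma amp_fconsS m (U W : lmodType K) (P : 'M[K]_m) (A : 'I_n -> 'M[K]_m)
   (f : 'I_n -> U -> W) : amp (fcons P A \o lift ord0) f = amp A f.
Proof. by apply: eq_amp => i /=; rewrite fconsS. Qed.

Lemma amp_zero m (f : 'I_n -> H -> H) x :
  amp (fun _ : 'I_n => 0 : 'M[K]_m) f x = 0.
Proof.
apply/ffunP => a; rewrite !ffunE big1 // => b _; rewrite big1 // => i _.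
by rewrite mxE scale0r.
Qed.

Lemma amp_unit m x : amp (fcons (1%:M : 'M[K]_m) (fun=> 0)) op x = x.
Proof.
rewrite (pairff_eta x) amp_op fcons0 !scal1 !amp_fconsS !amp_zero //.
by rewrite !addr0.
Qed.

Lemma bndS_unit m : bndS (fcons (1%:M : 'M[K]_m) (fun=> 0)) 1.
Proof. by move=> y; rewrite amp_unit mul1r. Qed.

Lemma form_op m (A : 'I_n.+1 -> 'M[K]_m) u v : (forall i, (A i)^H = A i) ->
  dot_pow ds (amp A op (pairff u v)) (pairff u v) =
  dot_pow d (scal (A ord0) u) u + dot_pow d (scal (A ord0) v) v +
  (2 * redot (dpw d) (amp (A \o lift ord0) e v) u)%:C.
Proof.
move=> hA; rewrite amp_op dot_pairff !dot_powDl amp_e'_adj.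
have -> : amp (fun i => ((A \o lift ord0) i)^H) e v = amp (A \o lift ord0) e v.
  by congr (_ v); apply: eq_amp => i /=.
by rewrite (dot_powC d u) addrACA addC_conj.
Qed.

Lemma fcons_herm m (P : 'M[K]_m) (A : 'I_n -> 'M[K]_m) :
  P^H = P -> (forall i, (A i)^H = A i) -> forall i, (fcons P A i)^H = fcons P A i.
Proof. by move=> hP hA i; rewrite /fcons; case: unliftP. Qed.

(** The form at (u, v) is |u|^2 + |v|^2 + 2 Re <T v, u> with T = Σ A_i ⊗ e_i; its
    minimum over u is at u = - T v, with value |v|^2 - |T v|^2. *)
Lemma posS_unital m (A : 'I_n -> 'M[K]_m) : (forall i, (A i)^H = A i) ->
  posS (fcons 1%:M A) <-> sqbound (dpw d) (amp A e) 1.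
Proof.
move=> hA; have hu := fcons_herm (adj1 R m) hA.
have E u v : dot_pow ds (amp (fcons 1%:M A) op (pairff u v)) (pairff u v) =
    (sqnorm (dpw d) u + sqnorm (dpw d) v + 2 * redot (dpw d) (amp A e v) u)%:C.
  rewrite form_op // fcons0 !scal1 amp_fconsS !dot_powxx.
  by rewrite -!rmorphD.
split=> h.
  move=> v; have := h (pairff (- amp A e v) v); rewrite E ler0c sqnormN redotNr redotxx.
  by clear; lra.
move=> x; rewrite (pairff_eta x) E ler0c; set u := finfun _; set v := finfun _.
have := sqnorm_ge0 (dpw d) (u + amp A e v); have := h v; rewrite sqnormD redotC.
by clear; lra.
Qed.

Lemma posS_one m : posS (fcons (1%:M : 'M[K]_m) (fun=> 0)).
Proof.
apply/posS_unital => [i|x]; first by rewrite trmx0 map_mx0.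
by rewrite amp_zero sqnorm0 mul1r sqnorm_ge0.
Qed.

Lemma posS_scale m (A : 'I_n.+1 -> 'M[K]_m) (c : R) : 0 <= c -> posS A ->
  posS (fun i => c%:C *: A i).
Proof.
by move=> c0 pA x; rewrite ampZl dot_powZl mulr_ge0 ?ler0c.
Qed.

Lemma dot_pow_vec m (h : H) (y z : 'cV[K]_m) :
  dot_pow d [ffun a => y a ord0 *: h] [ffun a => z a ord0 *: h] =
  dot_mx y z * d h h.
Proof.
rewrite dot_mxE mulr_suml; apply: eq_bigr => a _.
by rewrite !ffunE dotZl dotZr big_ord1 mulrA.
Qed.

(** The compression of Σ A_i ⊗ H_i to the vectors z ⊗ (h, 0) is A_0. *)
Lemma posS_psd m (A : 'I_n.+1 -> 'M[K]_m) : posS A -> psd (A ord0).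
Proof.
move=> pA z; have [h nh] := unit_vec.
have := pA (pairff [ffun a => z a ord0 *: h] 0); rewrite form_op; last first.
  exact: posS_herm.
have -> : amp (A \o lift ord0) e 0 = 0.
  by rewrite -[0 in LHS](scale0r 0) ampZ ?scale0r //; exact: lin_e.
rewrite dot_pow0r addr0 /redot dot0l mulr0 addr0.
have -> : scal (A ord0) [ffun a => z a ord0 *: h] =
    [ffun a => (A ord0 *m z) a ord0 *: h].
  apply/ffunP => a; rewrite !ffunE mxE scaler_suml; apply: eq_bigr => b _.
  by rewrite ffunE scalerA.
by rewrite dot_pow_vec dotxx nh mulr1.
Qed.

(** The coefficients of Σ A_i ⊗ H_i + eps ⊗ H_0. *)
Definition shift m (eps : R) (A : 'I_n.+1 -> 'M[K]_m) i : 'M[K]_m :=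
  A i + eps%:C *: fcons 1%:M (fun=> 0) i.

Lemma shiftE m eps (A : 'I_n.+1 -> 'M[K]_m) :
  shift eps A =1 fcons (A ord0 + (eps%:C)%:M) (A \o lift ord0).
Proof.
move=> i; rewrite /shift /fcons; case: unliftP => [j|] -> /=.
  by rewrite scaler0 addr0.
by rewrite scalemx1.
Qed.

Lemma posS_shift m eps (A : 'I_n.+1 -> 'M[K]_m) : 0 <= eps -> posS A ->
  posS (shift eps A).
Proof.
by move=> e0 pA; apply: posS_add => //; apply: posS_scale => //; exact: posS_one.
Qed.

(** With A_0 + eps = E^H E, congruence by the inverse of E replaces A_0 + eps
    by 1. *)
Lemma normalize m eps (A : 'I_n.+1 -> 'M[K]_m) : (forall i, (A i)^H = A i) ->
  psd (A ord0) -> 0 < eps ->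
  exists (E : 'M[K]_m) (A1 : 'I_n -> 'M[K]_m),
  [/\ E \in unitmx, forall i, (A1 i)^H = A1 i,
    shift eps A =1 (fun i => E^H *m fcons 1%:M A1 i *m E) &
    fcons 1%:M A1 =1 (fun i => (invmx E)^H *m shift eps A i *m invmx E)].
Proof.
move=> hA pA e0; have [E [hE /(_ e0) uE]] := pd_factor (hA ord0) pA (ltW e0).
have EG : E^H *m (invmx E)^H = 1%:M by rewrite -adjM mulVmx // adj1.
have GE : (invmx E)^H *m E^H = 1%:M by rewrite -adjM mulmxV // adj1.
pose A1 i := (invmx E)^H *m A (lift ord0 i) *m invmx E.
exists E, A1; split=> //.
- by move=> i; rewrite /A1 !adjM adjK hA mulmxA.
- move=> i; rewrite shiftE /fcons; case: unliftP => [j|] _ /=.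
    by rewrite /A1 !mulmxA EG mul1mx -mulmxA mulVmx // mulmx1.
  by rewrite hE mulmx1.
- move=> i; rewrite shiftE /fcons; case: unliftP => [j|] _ //=.
  by rewrite hE mulmxA GE mul1mx mulmxV.
Qed.

Lemma normalize_contraction m eps (A : 'I_n.+1 -> 'M[K]_m) : posS A -> 0 < eps ->
  exists (E : 'M[K]_m) (A1 : 'I_n -> 'M[K]_m),
  [/\ forall i, (A1 i)^H = A1 i,
    shift eps A =1 (fun i => E^H *m fcons 1%:M A1 i *m E) &
    sqbound dot_mx (Phi A1) 1].
Proof.
move=> pA e0.
have [E [A1 [uE hA1 sE sE']]] := normalize (posS_herm pA) (posS_psd pA) e0.
exists E, A1; split=> //.
have := @OH_sqbound _ A1 1 ler01; rewrite !expr1n => -[+ _].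
apply; apply/posS_unital => //.
apply: (eq_posS (fsym sE')); apply: posS_congr; apply: posS_shift => //.
exact: ltW.
Qed.

(** * The order isomorphism *)

Definition posD m (A : 'I_n.+1 -> 'M[K]_m) : Prop :=
  forall k (B : 'I_n.+1 -> 'M[K]_k), posS B ->
  forall X, 0 <= dot_mx (Psi A B X) X.

Lemma Psi_shift m k eps eps' (A : 'I_n.+1 -> 'M[K]_m) (B : 'I_n.+1 -> 'M[K]_k) X :
  Psi (shift eps A) (shift eps' B) X = Psi A B X + eps%:C *: (X *m (B ord0)^T) +
   eps'%:C *: (A ord0 *m X) + (eps * eps')%:C *: X.
Proof.
rewrite (eq_Psi (shiftE eps A) (shiftE eps' B)) Psi_fcons.
rewrite (eq_Psi (fcons_eta A) (fcons_eta B)) Psi_fcons.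
rewrite linearD /= tr_scalar_mx !mulmxDl !mulmxDr mul_scalar_mx !mul_mx_scalar.
rewrite -!scalemxAl !scalerA -rmorphM /= (mulrC eps').
by rewrite addr5.
Qed.

(** After the normalisation of both families the form at X becomes
    |Y|^2 + <Psi A1 B1 Y, Y>, where Y = E X F^T. *)
Lemma posS_posD m (A : 'I_n.+1 -> 'M[K]_m) : posS A -> posD A.
Proof.
move=> pA k B pB X; have hA := posS_herm pA; have hB := posS_herm pB.
apply: ge0_conj.
  rewrite -dotC Psi_herm; congr (dot_mx _ _).
  by congr (_ X); apply: eq_Psi.
apply: (@ge0_eps _ _ (redot dot_mx (X *m (B ord0)^T) X + redot dot_mx (A ord0 *m X) X)
   (sqnorm dot_mx X)) => eps e0.
have [E [A1 [hA1 sA bA]]] := normalize_contraction pA e0.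
have [F [B1 [hB1 sB bB]]] := normalize_contraction pB e0.
have : 0 <= redot dot_mx (Psi (shift eps A) (shift eps B) X) X.
  rewrite (eq_Psi sA sB) -[redot _ _ _]/(Re (dot_mx _ _)) Psi_congr.
  set Y := E *m X *m F^T.
  rewrite -[Re _]/(redot dot_mx _ _) Psi_fcons mul1mx trmx1 mulmx1 redotDl redotxx.
  have := haagerup hA1 hB1 bA bB Y; clear; lra.
rewrite Psi_shift !redotDl !redotZl redotxx -[Re _]/(redot dot_mx _ _) -expr2.
by rewrite mulrDr !addrA.
Qed.

Lemma OH_contraction m (A : 'I_n -> 'M[K]_m) : sqbound dot_mx (Phi A) 1 ->
  sqbound (dpw d) (amp A e) 1.
Proof.
have := @OH_sqbound m A 1 ler01; rewrite !expr1n => -[_ +]; exact.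
Qed.

Lemma Phi_delta j X : Phi (fun i : 'I_n => ((i == j)%:R)%:M : 'M[K]_1) X = X.
Proof.
rewrite [LHS](bigD1 j) //= big1 ?addr0 => [|l lj].
  by rewrite eqxx adj1 mul1mx mulmx1.
by rewrite (negPf lj) raddf0 !mul0mx.
Qed.

Lemma delta_herm j i : (((i == j :> 'I_n)%:R)%:M : 'M[K]_1)^H = ((i == j)%:R)%:M.
Proof. by case: eqP => _; rewrite ?adj1 // raddf0 trmx0 map_mx0. Qed.

Lemma posD_unital m k (A : 'I_n.+1 -> 'M[K]_m) (B : 'I_n -> 'M[K]_k) X : posD A ->
  (forall i, (B i)^H = B i) -> sqbound dot_mx (Phi B) 1 ->
  0 <= dot_mx (A ord0 *m X + Psi (A \o lift ord0) B X) X.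
Proof.
move=> pA hB bB; have pB : posS (fcons 1%:M B).
  by apply/posS_unital => //; exact: OH_contraction.
have := pA _ _ pB X; rewrite (eq_Psi (fcons_eta A) (frefl (fcons 1%:M B))).
by rewrite Psi_fcons trmx1 mulmx1.
Qed.

Lemma posD_psd m (A : 'I_n.+1 -> 'M[K]_m) : posD A -> psd (A ord0).
Proof.
move=> pA X; have := posD_unital (B := fun=> 0) X pA.
have -> : Psi (A \o lift ord0) (fun=> 0 : 'M[K]_1) X = 0.
  by rewrite /Psi big1 // => i _; rewrite trmx0 mulmx0.
rewrite addr0; apply; first by move=> i; rewrite trmx0 map_mx0.
move=> Y; rewrite [Phi _ _]big1 => [|i _]; last by rewrite !mul0mx.
by rewrite sqnorm0 mul1r sqnorm_ge0.
Qed.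

(** H_0 + H_j is positive, so A_0 + A_j is a value of the positive map
    Σ A_i ⊗ δ_i, as is A_0. *)
Lemma posD_herm m (A : 'I_n.+1 -> 'M[K]_m) : posD A -> forall i, (A i)^H = A i.
Proof.
move=> pA; have h0 := psd_herm (posD_psd pA).
move=> i; rewrite (fcons_eta A) /fcons; case: unliftP => [j _|//].
pose B (i : 'I_n) := ((i == j)%:R)%:M : 'M[K]_1.
have hB l : (B l)^H = B l by exact: delta_herm.
have bB : sqbound dot_mx (Phi B) 1 by move=> X; rewrite mul1r Phi_delta.
have /psd_herm : psd (A ord0 + A (lift ord0 j)).
  move=> X; have := posD_unital X pA hB bB.
  have -> : Psi (A \o lift ord0) B X = A (lift ord0 j) *m X.
    rewrite /Psi (bigD1 j) //= /B eqxx trmx1 mulmx1 big1 ?addr0 // => l lj.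
    by rewrite (negPf lj) raddf0 trmx0 mulmx0.
  by rewrite mulmxDl.
by rewrite adjD h0 => /addrI.
Qed.

Lemma posD_shift m eps (A : 'I_n.+1 -> 'M[K]_m) : 0 <= eps -> posD A ->
  posD (shift eps A).
Proof.
move=> e0 pA k B pB X.
have -> : Psi (shift eps A) B X =
    Psi A B X + Psi (fun i => eps%:C *: fcons 1%:M (fun=> 0) i) B X.
  by rewrite /Psi -big_split; apply: eq_bigr => i _; rewrite /= -!mulmxDl.
rewrite dot_mxDl addr_ge0 //; first exact: pA.
apply: posS_posD => //.
by apply: posS_scale => //; exact: posS_one.
Qed.

Lemma posD_congr m r (A : 'I_n.+1 -> 'M[K]_m) (E : 'M[K]_(m, r)) : posD A ->
  posD (fun i => E^H *m A i *m E).
Proof.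
move=> pA k B pB X.
have hB : B =1 (fun i => 1%:M^H *m B i *m 1%:M).
  by move=> i; rewrite adj1 mul1mx mulmx1.
rewrite (eq_Psi (frefl (fun i => E^H *m A i *m E)) hB) Psi_congr; exact: pA.
Qed.

(** Testing on B = s conj A / r with s = 1 and s = - 1, for which [Phi B] is a
    contraction, gives |<Phi A X, X>| <= r |X|^2.  As [Phi A] is hermitian, its norm
    r^2 is at most r. *)
Lemma posD_unital_bnd m (A : 'I_n -> 'M[K]_m) : (forall i, (A i)^H = A i) ->
  posD (fcons 1%:M A) -> sqbound dot_mx (Phi A) 1.
Proof.
move=> hA pA; have [r [r0 br rmin]] := Phi_norm A.
have [req|rN0] := eqVneq r 0.
  by apply: sqbound_le br; rewrite req expr0n ler01.
have rp : 0 < r by rewrite lt_def rN0.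
have key (s : R) : s ^+ 4 = 1 -> forall X,
    0 <= sqnorm dot_mx X + (s / r) * redot dot_mx (Phi A X) X.
  move=> s4 X; pose B i := (s / r)%:C *: map_mx Num.conj (A i).
  have hB i : (B i)^H = B i.
    by rewrite /B adjZ conj_realC -map_trmx map_trmx -[in RHS](hA i) map_trmx.
  have bB : sqbound dot_mx (Phi B) 1.
    have := sqbound_Phi_scale (s / r) (sqbound_Phi_conj br).
    by rewrite -exprMn divfK // s4.
  have := posD_unital X pA hB bB.
  rewrite fcons0 mul1mx.
  have -> : Psi (fcons 1%:M A \o lift ord0) B X = (s / r)%:C *: Phi A X.
    rewrite -Psi_conj /Psi scaler_sumr; apply: eq_bigr => i _ /=.
    by rewrite fconsS /B linearZ /= -scalemxAr.
  rewrite dot_mxDl dot_mxZl dot_mxxx.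
  by move=> /ger0_Re_ge0; rewrite cReD cReZ.
have hr X : `|redot dot_mx (Phi A X) X| <= r * sqnorm dot_mx X.
  have h1 := key 1 (expr1n _ _) X.
  have h2 := key (-1) (ltac:(ring)) X.
  have e1 : r * (sqnorm dot_mx X + 1 / r * redot dot_mx (Phi A X) X) =
    r * sqnorm dot_mx X + redot dot_mx (Phi A X) X by field.
  have e2 : r * (sqnorm dot_mx X + (- 1) / r * redot dot_mx (Phi A X) X) =
    r * sqnorm dot_mx X - redot dot_mx (Phi A X) X by field.
  rewrite -(pmulr_rge0 _ rp) e1 in h1; rewrite -(pmulr_rge0 _ rp) e2 in h2.
  exact: norm_le_of_signs.
have b2 : sqbound dot_mx (Phi A) (r ^+ 2).
  apply: numerical_radius => //.
  - by move=> X Y; rewrite /Phi -big_split; apply: eq_bigr => i _; rewrite mulmxDr mulmxDl.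
  - move=> a X; rewrite /Phi scaler_sumr; apply: eq_bigr => i _.
    by rewrite -scalemxAr -scalemxAl.
  - move=> X Y; rewrite /redot -!Psi_conj; congr Re; rewrite -[LHS]/(dot_mx _ _) Psi_herm.
    congr (dot_mx _ _); congr (_ Y); apply: eq_Psi => // i.
    by rewrite -map_trmx map_trmx -[in RHS](hA i) map_trmx.
have := rmin _ r0 b2; rewrite expr2 ger_pMr // => r1.
apply: sqbound_le br; exact: exprn_ile1.
Qed.

(** Both the normalisation and the criterion [posS_unital] are equivalences, so the
    unital case is enough. *)
Lemma posD_posS m (A : 'I_n.+1 -> 'M[K]_m) : posD A -> posS A.
Proof.
move=> pA x; have hA := posD_herm pA.
apply: ge0_conj.
  by rewrite -dot_powC amp_op_adj (eq_amp op hA).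
apply: (@ge0_eps _ _ (sqnorm (dpw ds) x) 0) => eps e0; rewrite mulr0 addr0.
have [E [A1 [uE hA1 sE sE']]] := normalize hA (posD_psd pA) e0.
have pA1 : posD (fcons 1%:M A1).
  by rewrite (funext sE'); apply: posD_congr; apply: posD_shift => //; exact: ltW.
have pS : posS (shift eps A).
  rewrite (funext sE); apply: posS_congr => //.
  by apply/posS_unital => //; apply: OH_contraction; exact: posD_unital_bnd.
have := pS x; rewrite /shift ampDl ampZl dot_powDl dot_powZl.
by rewrite amp_unit => /ger0_Re_ge0; rewrite dot_powxx cReD cReZ.
Qed.

(** * Comparison of the norms *)

Lemma fcons_scalar m (c : R) i : fcons (c%:C%:M : 'M[K]_m) (fun _ : 'I_n => 0) i =
  c%:C *: fcons 1%:M (fun=> 0) i.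
Proof.
by rewrite /fcons; case: unliftP => [j|] _; rewrite ?scaler0 ?scalemx1.
Qed.

Lemma amp_scalar m (c : R) x :
  amp (fcons (c%:C%:M : 'M[K]_m) (fun _ : 'I_n => 0)) op x = c%:C *: x.
Proof. by rewrite (eq_amp op (fcons_scalar _ c)) ampZl amp_unit. Qed.

(** For c > 0 this is |c x + T y|^2 >= 0, where T = Σ A_i ⊗ H_i, divided by c. *)
Lemma posS_block m (A : 'I_n.+1 -> 'M[K]_m) (c : R) : 0 <= c ->
  bndS A (c ^+ 2) ->
  posS (fun i => block_mx (fcons c%:C%:M (fun=> 0) i) (A i) (A i)^H
                          (fcons c%:C%:M (fun=> 0) i)).
Proof.
move=> c0 bA z; rewrite (catff_eta z) amp_block dot_catff !amp_scalar.
set x := finfun _; set y := finfun _.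
rewrite !dot_powDl !dot_powZl !dot_powxx (amp_op_adj (fun i => (A i)^H)).
have -> : amp (fun i => ((A i)^H)^H) op y = amp A op y.
  by rewrite (eq_amp op (fun i => adjK (A i))).
rewrite (dot_powC _ x) conj_form_sum ler0c -[Re _]/(redot (dpw ds) _ _).
have bAy := bA y.
have [c_eq0|cN0] := eqVneq c 0.
  have Ay0 : amp A op y = 0.
    apply/eqP; rewrite -(sqnorm_eq0 (dpw ds)) eq_le sqnorm_ge0 andbT.
    by move: bAy; rewrite c_eq0 expr0n mul0r.
  by rewrite c_eq0 Ay0 !mul0r add0r add0r /redot dot0l mulr0.
have cp : 0 < c by rewrite lt_def cN0.
rewrite -(pmulr_rge0 _ cp).
have := sqnorm_ge0 (dpw ds) (c%:C *: x + amp A op y).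
rewrite sqnormD sqnormZ redotZl (redotC _ x) => h.
apply: le_trans h _; move: bAy.
exact: block_bound.
Qed.

(** The block family is paired with the block family of B, at a block diagonal
    matrix: the form is c |X|^2 + c |Y|^2 + 2 Re <Psi A B Y, X>, and
    X = - Psi A B Y / c gives the bound.  The diagonal block P may have other
    coefficients than P_0, since they meet vanishing coefficients on the side of
    B. *)
Lemma bndD_of_posS_block m (A P : 'I_n.+1 -> 'M[K]_m) (c : R) : 0 <= c ->
  P ord0 = c%:C%:M ->
  posS (fun i => block_mx (P i) (A i) (A i)^H (P i)) ->
  forall k (B : 'I_n.+1 -> 'M[K]_k), bndS B 1 -> sqbound dot_mx (Psi A B) (c ^+ 2).
Proof.
move=> c0 P0 pAA k B bB Y.
have := @posS_block _ B 1 ler01; rewrite expr1n => /(_ bB) pBB.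
pose Q := fcons (1%:C%:M : 'M[K]_k) (fun _ : 'I_n => 0).
have PQ X : Psi P Q X = c%:C *: X.
  rewrite (eq_Psi (fcons_eta P) (frefl Q)) Psi_fcons P0 trmx1 mulmx1 mul_scalar_mx.
  by rewrite /Psi big1 ?addr0 // => i _; rewrite trmx0 mulmx0.
have key X : 0 <= c * sqnorm dot_mx X + c * sqnorm dot_mx Y + 2 * redot dot_mx (Psi A B Y) X.
  have := posS_posD pAA pBB (block_mx X 0 0 Y).
  rewrite [Psi _ _ _](_ : _ =
     block_mx (Psi P Q X + Psi A B Y) (Psi P (fun i => (B i)^H) X + Psi A Q Y)
       (Psi (fun i => (A i)^H) Q X + Psi P B Y)
       (Psi (fun i => (A i)^H) (fun i => (B i)^H) X + Psi P Q Y)).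
    rewrite dot_block_diag; set Z := Psi _ _ Y.
    rewrite {}/Z !PQ !dot_mxDl !dot_mxZl !dot_mxxx (Psi_herm (fun i => (A i)^H)).
    rewrite (eq_Psi (fun i => adjK (A i)) (fun i => adjK (B i))) (dot_mxC X).
    by rewrite conj_form_sum ler0c.
  rewrite /Psi -!big_split -sum_block; apply: eq_bigr => i _ /=.
  by rewrite !mulmx_block tr_block_mx !mulmx0 addr0 add0r addr0 add0r mulmx_block.
have [c_eq0|cN0] := eqVneq c 0.
  rewrite c_eq0 expr0n mul0r; have := key (- Psi A B Y).
  by rewrite c_eq0 !mul0r !add0r redotNr redotxx mulrN oppr_ge0 pmulr_rle0.
have cp : 0 < c by rewrite lt_def cN0.
have := key ((- c^-1)%:C *: Psi A B Y).
rewrite sqnormZ redotZr redotxx sqrrN.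
have -> : c * (c^-1 ^+ 2 * sqnorm dot_mx (Psi A B Y)) + c * sqnorm dot_mx Y +
    2 * (- c^-1 * sqnorm dot_mx (Psi A B Y)) =
    (c ^+ 2 * sqnorm dot_mx Y - sqnorm dot_mx (Psi A B Y)) / c by field.
by rewrite pmulr_lge0 ?invr_gt0 // subr_ge0.
Qed.

Lemma bndD_of_bndS m (A : 'I_n.+1 -> 'M[K]_m) (c : R) : 0 <= c ->
  bndS A (c ^+ 2) ->
  forall k (B : 'I_n.+1 -> 'M[K]_k), bndS B 1 -> sqbound dot_mx (Psi A B) (c ^+ 2).
Proof.
move=> c0 bA; apply: (bndD_of_posS_block c0 _ (posS_block c0 bA)).
by rewrite fcons0.
Qed.

(** The corners of Σ A_i ⊗ H_i (i >= 1) are Σ A_i ⊗ e_i and Σ A_i ⊗ e_i^*.  The second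
    is the adjoint of Σ A_i^H ⊗ e_i, and Phi (A^H) is the adjoint of [Phi A], so both
    corners have the same norm. *)
Lemma bndS_off m (A : 'I_n -> 'M[K]_m) (r : R) : 0 <= r ->
  sqbound dot_mx (Phi A) (r ^+ 4) -> bndS (fcons 0 A) (r ^+ 2).
Proof.
move=> r0 bA.
have b1 : sqbound (dpw d) (amp A e) (r ^+ 2) by apply/OH_sqbound.
have b2 : sqbound (dpw d) (amp A e') (r ^+ 2).
  have bA' := sqbound_Phi_adj (exprn_ge0 4 r0) bA.
  have : sqbound (dpw d) (amp (fun i => (A i)^H) e) (r ^+ 2) by exact/OH_sqbound.
  apply: sqbound_adjoint; last by rewrite exprn_ge0.
  by move=> x y; congr Re; exact: amp_e'_adj.
move=> x; rewrite (pairff_eta x); set u := finfun _; set v := finfun _.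
have s0 w : scal (0 : 'M[K]_m) w = 0 :> {ffun 'I_m -> H}.
  by apply/ffunP => a; rewrite !ffunE big1 // => b _; rewrite mxE scale0r.
rewrite amp_op fcons0 !s0 !add0r !amp_fconsS !sqnorm_pairff mulrDr addrC.
by apply: lerD; [exact: b2|exact: b1].
Qed.

(** Evaluation at H_0 bounds A_0 by c.  For the other part, let r^2 be the norm of
    [Phi A] over i >= 1; conj A / r has norm at most 1 and evaluation there yields
    [Phi A] / r, so r^2 <= c r. *)
Lemma bndS_of_bndD m (A : 'I_n.+1 -> 'M[K]_m) (c : R) : 0 <= c ->
  (forall k (B : 'I_n.+1 -> 'M[K]_k), bndS B 1 -> sqbound dot_mx (Psi A B) (c ^+ 2)) ->
  bndS A ((2 * c) ^+ 2).
Proof.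
move=> c0 hA; have b0 : bndS (fcons (A ord0) (fun=> 0)) (c ^+ 2).
  have : sqbound (dpw ds) (scal (A ord0)) (c ^+ 2).
    apply: scal_sqbound => x.
    have := hA _ _ (@bndS_unit 1) x; rewrite (eq_Psi (fcons_eta A) (frefl _)) Psi_fcons.
    by rewrite trmx1 mulmx1 [Psi _ _ _]big1 ?addr0 // => i _; rewrite trmx0 mulmx0.
  move=> h x; suff -> : amp (fcons (A ord0) (fun=> 0)) op x = scal (A ord0) x by exact: h.
  apply/ffunP => a; rewrite !ffunE; apply: eq_bigr => b _.
  rewrite big_ord_recl fcons0 SOH_op0 big1 ?addr0 // => i _.
  by rewrite fconsS mxE scale0r.
have b1 : bndS (fcons 0 (A \o lift ord0)) (c ^+ 2).
  have [r [r0 br rmin]] := Phi_norm (A \o lift ord0).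
  suff rc : r <= c.
    by apply: sqbound_le (bndS_off r0 br); rewrite ler_pXn2r ?nnegrE.
  have [->//|rN0] := eqVneq r 0.
  have rp : 0 < r by rewrite lt_def rN0.
  pose B i := r^-1%:C *: map_mx Num.conj (A (lift ord0 i)).
  have bB : bndS (fcons 0 B) 1.
    have := @bndS_off _ B 1 ler01; rewrite !expr1n; apply.
    have := sqbound_Phi_scale (r^-1) (sqbound_Phi_conj br).
    by rewrite -exprMn mulVf // expr1n.
  have := rmin (c * r); rewrite [r ^+ 2]expr2 ler_pM2r //; apply; first exact: mulr_ge0.
  move=> X; have := hA _ _ bB X.
  rewrite (eq_Psi (fcons_eta A) (frefl _)) Psi_fcons trmx0 mulmx0 add0r.
  have -> : Psi (A \o lift ord0) B X = r^-1%:C *: Phi (A \o lift ord0) X.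
    rewrite -Psi_conj /Psi scaler_sumr; apply: eq_bigr => i _ /=.
    by rewrite /B linearZ /= -scalemxAr.
  rewrite sqnormZ exprVn mulrC ler_pdivrMr ?exprn_gt0 // => h.
  by apply: le_trans h _; rewrite exprMn mulrAC.
move=> x; have -> : amp A op x = amp (fcons (A ord0) (fun=> 0)) op x +
     amp (fcons 0 (A \o lift ord0)) op x.
  rewrite -ampDl; congr (_ x); apply: eq_amp => i.
  by rewrite (fcons_eta A) /fcons; case: unliftP => [j|] _ /=; rewrite ?add0r ?addr0.
apply: le_trans (sqnormD_le _ _ _) _.
have := b0 x; have := b1 x.
have -> : (2 * c) ^+ 2 * sqnorm (dpw ds) x = 2 * (c ^+ 2 * sqnorm (dpw ds) x) +
  2 * (c ^+ 2 * sqnorm (dpw ds) x) by ring.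
by move=> h1 h2; apply: lerD; rewrite ler_pM2l.
Qed.

(** If 1 + H_j has norm at most c, its form is at most c |(u, v)|^2, that is,
    2 Re <e_j v, u> <= (c - 1) (|u|^2 + |v|^2).  So e_j has norm at most c - 1, and
    this norm is 1. *)
Lemma bndS_sum_ge2 j (c : R) : 0 <= c ->
  bndS (fcons (1%:M : 'M[K]_1) (fun i => ((i == j)%:R)%:M)) (c ^+ 2) -> 2 <= c.
Proof.
move=> c0 bc; pose D (i : 'I_n) : 'M[K]_1 := ((i == j)%:R)%:M.
have PD X : Phi D X = X by exact: Phi_delta.
have hD i : (D i)^H = D i by exact: delta_herm.
have key (s : R) : 0 <= s -> sqbound (dpw d) (amp D e) (s ^+ 2) -> 1 <= s.
  move=> s0 /OH_sqbound => /(_ s0) /(_ 1%:M); rewrite PD.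
  have n1 : 0 < sqnorm dot_mx (1%:M : 'M[K]_1).
    by rewrite lt_def sqnorm_ge0 andbT sqnorm_eq0 oner_eq0.
  rewrite -[X in X <= _]mul1r ler_pM2r // => h.
  by rewrite -(ler_pXn2r (n := 4)) ?nnegrE // expr1n.
have ineq u v : 2 * redot (dpw d) (amp D e v) u <= (c - 1) * (sqnorm (dpw d) v + sqnorm (dpw d) u).
  have := sqbound_redot c0 bc (pairff u v).
  rewrite -[redot (dpw ds) _ _]/(Re (dot_pow ds _ _)).
  rewrite (form_op _ _ (fcons_herm (adj1 R 1) hD)) fcons0 !scal1.
  rewrite amp_fconsS !dot_powxx -!rmorphD /= sqnorm_pairff.
  exact: shifted_bound.
have [s0|s0] := ltP 0 (c - 1).
  suff : 1 <= c - 1 by lra.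
  apply: key (ltW s0) _ => v.
  have := ineq ((c - 1)^-1%:C *: amp D e v) v.
  rewrite redotZr redotxx sqnormZ; move: s0 (sqnorm _ v) (sqnorm _ _) => s0 p q.
  set s := c - 1 in s0 *.
  have -> : s * (p + s^-1 ^+ 2 * q) = (s ^+ 2 * p + q) / s by field; rewrite gt_eqF.
  rewrite (_ : 2 * (s^-1 * q) = (2 * q) / s); last by rewrite mulrA mulrAC.
  by rewrite ler_pM2r ?invr_gt0 //; exact: sq_cancel.
have : (1 : R) <= 0; last by lra.
apply: key => // v; rewrite expr0n mul0r.
have := ineq (amp D e v) v; rewrite redotxx.
by apply: nonpos_bound; rewrite ?sqnorm_ge0.
Qed.

(** * From coefficient families to the operator systems *)

Lemma val_tens m (A : 'I_n.+1 -> 'M[K]_m) :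
  map_mx (@span_val _ _ _ op) (tens_sum A gen : 'M[S]_m) = tens_sum A op.
Proof.
apply/matrixP => a b; rewrite !mxE -[LHS]/(val _) linear_sum.
by apply: eq_bigr => i _; rewrite linearZ.
Qed.

Lemma os_pos_gen m (A : 'I_n.+1 -> 'M[K]_m) :
  os_pos (tens_sum A gen : 'M[S]_m) <-> posS A.
Proof. by rewrite /= val_tens mxop_tens_sum. Qed.

Lemma os_norm_genE m (A : 'I_n.+1 -> 'M[K]_m) :
  os_norm (tens_sum A gen : 'M[S]_m) = op_norm (dpw ds) (amp A op).
Proof. by rewrite /= val_tens mxop_tens_sum. Qed.

Lemma os_norm_gen m (A : 'I_n.+1 -> 'M[K]_m) (c : R) : 0 <= c ->
  (os_norm (tens_sum A gen : 'M[S]_m) <= c%:E)%E <-> bndS A (c ^+ 2).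
Proof.
move=> c0; rewrite os_norm_genE; apply: op_norm_leE => // a x.
by apply: ampZ; exact: lin_op.
Qed.

Lemma span_coord (v : S) : exists a : 'I_n.+1 -> K, v = \sum_i a i *: gen i.
Proof.
case: v => v hv; have /asboolP[a va] := hv; exists a; apply: val_inj.
transitivity (\sum_i a i *: op i); first exact: va.
by rewrite linear_sum; apply: eq_bigr => i _; rewrite linearZ.
Qed.

Lemma gen_indep (a b : 'I_n.+1 -> K) :
  \sum_i a i *: gen i = \sum_i b i *: gen i -> a =1 b.
Proof.
have vE c : val (\sum_i c i *: gen i : S) = \sum_i c i *: op i.
  by rewrite linear_sum; apply: eq_bigr => i _; rewrite linearZ.
move=> /(congr1 val); rewrite !vE => ab i.
have : (a i)%:M = (b i)%:M :> 'M[K]_1.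
  apply: (amp_op_inj (A := fun i => (a i)%:M) (B := fun i => (b i)%:M)).
  move=> x; apply/ffunP => p; rewrite !ffunE !big_ord1.
  have /(congr1 (fun f => f (x ord0))) := ab; rewrite !fct_sumE => h.
  transitivity (\sum_i (a i *: op i) (x ord0)).
    by apply: eq_bigr => j _; rewrite mxE (ord1 p) eqxx mulr1n.
  by rewrite h; apply: eq_bigr => j _; rewrite mxE (ord1 p) eqxx mulr1n.
by move/matrixP/(_ ord0 ord0); rewrite !mxE eqxx !mulr1n.
Qed.

Lemma dual_scalar (f : dual S) : scalar f.
Proof. by case: f => f /= /asboolP[]. Qed.

Lemma dual_sum (f : dual S) (a : 'I_n.+1 -> K) :
  f (\sum_i a i *: gen i) = \sum_i a i * f (gen i).
Proof.
have fD u v : f (u + v) = f u + f v.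
  by rewrite -[u]scale1r dual_scalar mul1r scale1r.
have f0 : f 0 = 0 by apply: (addrI (f 0)); rewrite -fD !addr0.
rewrite (big_morph f fD f0); apply: eq_bigr => i _.
by rewrite -[_ *: _]addr0 dual_scalar f0 addr0.
Qed.

Lemma Psi_cols m k (A : 'I_n.+1 -> 'M[K]_m) (B : 'I_n.+1 -> 'M[K]_k)
   (z : {ffun 'I_k -> 'cV[K]_m}) :
  mx_of_cols (amp B (fun i => mulmx (A i) : 'cV_m -> 'cV_m) z) = Psi A B (mx_of_cols z).
Proof.
apply/matrixP => p a; rewrite mxE ffunE !summxE.
under eq_bigr do rewrite summxE; rewrite exchange_big; apply: eq_bigr => i _.
rewrite mxE; apply: eq_bigr => b _; rewrite !mxE mulrC; congr (_ * _).
by apply: eq_bigr => q _; rewrite !mxE.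
Qed.

Lemma op_pos_cols m k (A : 'I_n.+1 -> 'M[K]_m) (B : 'I_n.+1 -> 'M[K]_k) :
  op_pos (dpw (@dot_col R m)) (amp B (fun i => mulmx (A i) : 'cV_m -> 'cV_m)) <->
  forall X, 0 <= dot_mx (Psi A B X) X.
Proof.
set T := amp B _.
have E z : dot_pow (@dot_col R m) (T z) z = dot_mx (Psi A B (mx_of_cols z)) (mx_of_cols z).
  by rewrite -Psi_cols dot_pow_cols.
split=> [h X|h z].
  by rewrite -[X](@cols_of_mxK R) -E; exact: h.
suff : 0 <= dot_pow (@dot_col R m) (T z) z by [].
by rewrite E; exact: h.
Qed.

Lemma OH_gen_contraction i : sqbound d (e i) 1.
Proof.
move=> x; pose D (l : 'I_n) : 'M[K]_1 := ((l == i)%:R)%:M.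
have bD : sqbound dot_mx (Phi D) 1 by move=> X; rewrite Phi_delta mul1r.
have := OH_contraction bD [ffun=> x].
have nE y : sqnorm (dpw d) [ffun _ : 'I_1 => y] = sqnorm d y.
  by rewrite -[LHS]/(Re (dot_pow _ _ _)) /dot_pow big_ord1 !ffunE.
rewrite (_ : amp D e _ = [ffun=> e i x]) ?nE //.
apply/ffunP => a; rewrite !ffunE big_ord1 (bigD1 i) //= big1 ?addr0 => [|l li].
  by rewrite ffunE /D eqxx (ord1 a) mxE scale1r.
by rewrite /D (negPf li) raddf0 mxE scale0r.
Qed.

Lemma posS_sum j :
  posS (fcons (1%:M : 'M[K]_1) (fun i => ((i == j)%:R)%:M)).
Proof.
apply/posS_unital => // [i|]; first exact: delta_herm.
by apply: OH_contraction => // X; rewrite Phi_delta mul1r.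
Qed.

(** [bndD_of_bndS] bounds the pairing of (a_i) with the coefficients of H_0 and of
    the H_j, which have norm 1; this pairing is multiplication by a_i. *)
Lemma coef_le1 (a : 'I_n.+1 -> K) (v : S) : v = \sum_i a i *: gen i ->
  (os_norm (const_mx v : 'M[S]_1) <= 1)%E -> forall i, `|a i| <= 1.
Proof.
move=> va; have -> : (const_mx v : 'M[S]_1) = tens_sum (fun i => (a i)%:M) gen.
  apply/matrixP => p q; rewrite !mxE va; apply: eq_bigr => i _.
  by rewrite mxE !ord1 eqxx mulr1n.
move=> /(os_norm_gen _ ler01) => bA.
have hD := bndD_of_bndS ler01 bA.
have test (c : K) : sqnorm dot_mx (c%:M : 'M[K]_1) <= 1 -> `|c| <= 1.
  rewrite -lecR -dotxx [X in X <= _]dot_mxE !big_ord1 mxE eqxx mulr1n -normCK.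
  by rewrite expr_le1.
have n1 : sqnorm dot_mx (1%:M : 'M[K]_1) = 1.
  by rewrite -[LHS]/(Re (dot_mx _ _)) dot_mxE !big_ord1 mxE eqxx mulr1n mul1r conjC1.
move=> i; case: (unliftP ord0 i) => [j|] ->; apply: test.
  have b1 : bndS (fcons (0 : 'M[K]_1) (fun i => ((i == j)%:R)%:M)) 1.
    have := @bndS_off 1 (fun i => ((i == j)%:R)%:M) 1 ler01.
    by rewrite !expr1n; apply => X; rewrite Phi_delta mul1r.
  have := hD _ _ b1 1%:M; rewrite (eq_Psi (fcons_eta _) (frefl _)) Psi_fcons.
  rewrite trmx0 mulmx0 add0r [Psi _ _ _](bigD1 j) //= big1 ?addr0 => [|l lj].
    by rewrite eqxx trmx1 !mulmx1 n1 expr1n mul1r.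
  by rewrite (negPf lj) raddf0 trmx0 mulmx0.
have := hD _ _ (@bndS_unit 1) 1%:M; rewrite (eq_Psi (fcons_eta _) (frefl _)) Psi_fcons.
rewrite trmx1 !mulmx1 [Psi _ _ _]big1 ?addr0 => [|i' _]; last by rewrite trmx0 mulmx0.
by rewrite n1 expr1n mul1r.
Qed.

Lemma delta_exists : exists delta : 'I_n.+1 -> dual S,
  forall i j, delta i (gen j) = (i == j)%:R.
Proof.
have [c hc] := choice (@span_coord).
have cl i : scalar (fun v => c v i).
  move=> a u v; apply: (gen_indep (a := c (a *: u + v))
    (b := fun i => a * c u i + c v i) _ i).
  rewrite -hc {1}(hc u) {1}(hc v) scaler_sumr -big_split; apply: eq_bigr => l _.
  by rewrite scalerDl scalerA.
have cb i : (fun v => c v i) \in bounded_functional (S := SOH d e).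
  apply/asboolP; split; first exact: cl.
  by exists 1 => v v1; exact: (coef_le1 (hc v) v1).
exists (fun i => Functional (cb i)) => i j /=.
apply: (gen_indep (a := c (gen j)) (b := fun i => (i == j)%:R) _ i).
rewrite -hc (bigD1 j) //= eqxx scale1r big1 ?addr0 // => l /negPf ->.
by rewrite scale0r.
Qed.

Section Delta.
Variable delta : 'I_n.+1 -> dual S.
Hypothesis hdelta : forall i j, delta i (gen j) = (i == j)%:R.

Lemma delta_coord (a : 'I_n.+1 -> K) j : delta j (\sum_i a i *: gen i) = a j.
Proof.
rewrite dual_sum (bigD1 j) //= hdelta eqxx mulr1 big1 ?addr0 // => i /negPf ij.
by rewrite hdelta eq_sym ij mulr0.
Qed.

Lemma span_delta (v : S) : v = \sum_i delta i v *: gen i.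
Proof.
have [a va] := span_coord v; rewrite {1}va.
by apply: eq_bigr => i _; rewrite va delta_coord.
Qed.

Lemma mx_delta m (X : 'M[S]_m) :
  X = tens_sum (fun i => \matrix_(a, b) delta i (X a b)) gen.
Proof.
apply/matrixP => a b; rewrite mxE {1}(span_delta (X a b)).
by apply: eq_bigr => i _; rewrite mxE.
Qed.

Lemma dual_valE (F : 'I_n.+1 -> dual S) (c : 'I_n.+1 -> K) (v : S) :
  (\sum_i c i *: F i : dual S) v = \sum_i c i * F i v.
Proof.
rewrite -[functional _]/(val (_ : dual_type S)) linear_sum fct_sumE.
by apply: eq_bigr => i _; rewrite linearZ.
Qed.

Lemma dual_delta (f : dual S) : f = \sum_i f (gen i) *: delta i.
Proof.
apply: val_inj; apply/funext => v.
transitivity (\sum_i f (gen i) * delta i v); last exact/esym/dual_valE.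
rewrite -[LHS]/(functional f v) {1}(span_delta v) dual_sum.
by apply: eq_bigr => i _; rewrite mulrC.
Qed.

Lemma mx_dual_delta m (F : 'M[dual S]_m) :
  F = tens_sum (fun i => \matrix_(a, b) F a b (gen i)) delta.
Proof.
apply/matrixP => a b; rewrite mxE {1}(dual_delta (F a b)).
by apply: eq_bigr => i _; rewrite mxE.
Qed.

(** The value of Σ A_i ⊗ δ_i at Σ B_i ⊗ H_i is Σ B_i ⊗ A_i. *)
Lemma mxop_functional m k (A : 'I_n.+1 -> 'M[K]_m) (B : 'I_n.+1 -> 'M[K]_k) :
  mxop (map_mx (mulmx : 'M[K]_m -> 'cV_m -> 'cV_m)
     (map_mx (mx_functional (tens_sum A delta : 'M[dual S]_m)) (tens_sum B gen : 'M[S]_k))) =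
  amp B (fun i => mulmx (A i) : 'cV_m -> 'cV_m).
Proof.
apply/funext => z; apply/ffunP => a; rewrite !ffunE; apply: eq_bigr => b _.
rewrite !mxE.
have -> : mx_functional (tens_sum A delta : 'M[dual S]_m)
   (\sum_i B i a b *: gen i : S) = \sum_i B i a b *: A i.
  apply/matrixP => p q; rewrite !mxE dual_valE summxE.
  by apply: eq_bigr => i _; rewrite delta_coord mxE mulrC.
by rewrite mulmx_suml; apply: eq_bigr => i _; rewrite scalemxAl.
Qed.

Lemma os_pos_delta m (A : 'I_n.+1 -> 'M[K]_m) :
  os_pos (tens_sum A delta : 'M[dual S]_m) <-> posD A.
Proof.
split=> h.
  move=> k B /os_pos_gen pB; apply/op_pos_cols; rewrite -mxop_functional.
  exact: h.
suff : completely_positive (mx_functional (tens_sum A delta : 'M[dual S]_m)) by [].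
move=> k X; rewrite (mx_delta X) => /os_pos_gen pB.
suff : op_pos (dpw (@dot_col R m)) (mxop (map_mx (mulmx : 'M[K]_m -> 'cV_m -> 'cV_m)
     (map_mx (mx_functional (tens_sum A delta : 'M[dual S]_m))
        (tens_sum (fun i => \matrix_(a, b) delta i (X a b)) gen : 'M[S]_k)))) by [].
by rewrite mxop_functional; apply/op_pos_cols; exact: h.
Qed.

Lemma os_norm_delta m (A : 'I_n.+1 -> 'M[K]_m) (c : R) : 0 <= c ->
  (os_norm (tens_sum A delta : 'M[dual S]_m) <= c%:E)%E <->
  (forall k (B : 'I_n.+1 -> 'M[K]_k), bndS B 1 -> sqbound dot_mx (Psi A B) (c ^+ 2)).
Proof.
move=> c0.
have key k (B : 'I_n.+1 -> 'M[K]_k) :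
   (op_norm (dot_pow (@dot_col R m) (m := k))
     (amp B (fun i => mulmx (A i) : 'cV_m -> 'cV_m)) <= c%:E)%E
   <-> sqbound dot_mx (Psi A B) (c ^+ 2).
  have -> : sqbound dot_mx (Psi A B) (c ^+ 2) <->
    sqbound (dot_pow (@dot_col R m) (m := k))
      (amp B (fun i => mulmx (A i) : 'cV_m -> 'cV_m)) (c ^+ 2).
    have nrz (z : {ffun 'I_k -> 'cV[K]_m}) :
        sqnorm (dot_pow (@dot_col R m) (m := k)) z = sqnorm dot_mx (mx_of_cols z).
      by rewrite -[LHS]/(Re (dot_pow _ _ _)) dot_pow_cols.
    split=> h z; first by rewrite !nrz Psi_cols; exact: h.
    by rewrite -[z](@cols_of_mxK R) -Psi_cols -!nrz; exact: h.
  apply: op_norm_leE => // a x; apply: ampZ => i b u v.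
  by rewrite mulmxDr scalemxAr.
split=> [h k B bB|h].
  apply/key; rewrite -mxop_functional; apply: le_trans h; apply: ereal_sup_ubound.
  exists k, (tens_sum B gen); split=> //.
  by apply/(os_norm_gen _ ler01); rewrite expr1n.
apply: ge_ereal_sup => _ [k [X [X1 ->]]].
move: X1; rewrite (mx_delta X) => /(os_norm_gen _ ler01); rewrite expr1n => /h/key.
by rewrite -mxop_functional.
Qed.

Lemma os_norm_delta_ge0 m (A : 'I_n.+1 -> 'M[K]_m) :
  (0 <= os_norm (tens_sum A delta : 'M[dual S]_m))%E.
Proof.
set X : 'M[S]_0 := tens_sum (fun=> 0) gen.
apply: (@le_trans _ _ (os_norm (map_mx (mx_functional (tens_sum A delta : 'M[dual S]_m)) X))).
  exact: op_norm_ge0.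
apply: ereal_sup_ubound; exists 0%N, X; split=> //.
apply/(os_norm_gen _ ler01) => x; rewrite (_ : amp _ _ _ = 0).
  by rewrite sqnorm0 mulr_ge0 ?sqnorm_ge0 // expr1n.
by apply/ffunP => -[].
Qed.

Lemma dual_norm_le m (A : 'I_n.+1 -> 'M[K]_m) :
  (os_norm (tens_sum A delta : 'M[dual S]_m) <= os_norm (tens_sum A gen : 'M[S]_m))%E.
Proof.
have := op_norm_ge0 (dpw ds) (amp A op); rewrite -os_norm_genE.
case E : (os_norm (tens_sum A gen : 'M[S]_m)) => [c| |] //; last by rewrite !leey.
rewrite lee_fin => c0; apply/os_norm_delta => //.
apply: bndD_of_bndS => //; apply/os_norm_gen => //.
by rewrite E.
Qed.

Lemma norm_le_double m (A : 'I_n.+1 -> 'M[K]_m) :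
  (os_norm (tens_sum A gen : 'M[S]_m) <=
   2%:E * os_norm (tens_sum A delta : 'M[dual S]_m))%E.
Proof.
have := os_norm_delta_ge0 A.
case E : (os_norm (tens_sum A delta : 'M[dual S]_m)) => [c| |] //; last first.
  by rewrite gt0_muley ?lte_fin ?ltr0n // !leey.
rewrite lee_fin => c0; rewrite -EFinM; apply/os_norm_gen; first exact: mulr_ge0.
apply: bndS_of_bndD => //; apply/os_norm_delta => //.
by rewrite E.
Qed.

Lemma kappa_exists : exists kappa : {linear S -> dual S},
  forall i, kappa (gen i) = delta i.
Proof.
pose k (v : S) : dual S := \sum_i delta i v *: delta i.
have kl : linear k.
  move=> a u v; rewrite /k scaler_sumr -big_split; apply: eq_bigr => i _ /=.
  by rewrite dual_scalar scalerDl scalerA.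
pose kk : {linear S -> dual S} := HB.pack k (GRing.isLinear.Build _ _ _ _ k kl).
exists kk => i; rewrite /= /k (bigD1 i) //= hdelta eqxx scale1r big1 ?addr0 //.
by move=> j /negPf ji; rewrite hdelta ji scale0r.
Qed.

Lemma inv_exists : exists g : {linear dual S -> S},
  forall f : dual S, g f = \sum_i f (gen i) *: gen i.
Proof.
pose k (f : dual S) : S := \sum_i f (gen i) *: gen i.
have kl : linear k.
  move=> a u v; rewrite /k scaler_sumr -big_split; apply: eq_bigr => i _ /=.
  by rewrite scalerA -scalerDl.
pose kk : {linear dual S -> S} := HB.pack k (GRing.isLinear.Build _ _ _ _ k kl).
by exists kk.
Qed.

Variable kappa : {linear S -> dual S}.
Hypothesis hkappa : forall i, kappa (gen i) = delta i.
Variable g : {linear dual S -> S}.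
Hypothesis hg : forall f : dual S, g f = \sum_i f (gen i) *: gen i.

Lemma g_delta i : g (delta i) = gen i.
Proof.
rewrite hg (bigD1 i) //= hdelta eqxx scale1r big1 ?addr0 // => j /negPf ji.
by rewrite hdelta eq_sym ji scale0r.
Qed.

Lemma map_kappa m (A : 'I_n.+1 -> 'M[K]_m) :
  map_mx kappa (tens_sum A gen : 'M[S]_m) = tens_sum A delta.
Proof.
apply/matrixP => a b; rewrite !mxE linear_sum; apply: eq_bigr => i _.
by rewrite linearZ /= hkappa.
Qed.

Lemma map_g m (A : 'I_n.+1 -> 'M[K]_m) :
  map_mx g (tens_sum A delta : 'M[dual S]_m) = tens_sum A gen.
Proof.
apply/matrixP => a b; rewrite !mxE linear_sum; apply: eq_bigr => i _.
by rewrite linearZ /= g_delta.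
Qed.

Lemma kappa_iso : complete_order_iso kappa g.
Proof.
split.
- move=> v; rewrite [in RHS](span_delta v).
  rewrite {1}(span_delta v) !linear_sum.
  by apply: eq_bigr => i _; rewrite !linearZ /= hkappa g_delta.
- move=> f; rewrite [in RHS](dual_delta f).
  by rewrite hg linear_sum; apply: eq_bigr => i _; rewrite linearZ /= hkappa.
- move=> m X; rewrite (mx_delta X) => /os_pos_gen pA.
  rewrite map_kappa; apply/os_pos_delta => //.
  exact: posS_posD.
- move=> m F; rewrite (mx_dual_delta F) => /os_pos_delta pA.
  by rewrite map_g; apply/os_pos_gen; apply: posD_posS => //; exact: pA.
Qed.

Lemma bndD_unit_ge1 m (c : R) : 0 <= c -> (0 < m)%N ->
  sqbound dot_mx (Psi (fcons (1%:M : 'M[K]_m) (fun _ : 'I_n => 0))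
    (fcons (1%:M : 'M[K]_m) (fun=> 0))) (c ^+ 2) ->
  1 <= c.
Proof.
move=> c0 m0 /(_ 1%:M).
have n1 : 0 < sqnorm dot_mx (1%:M : 'M[K]_m).
  rewrite lt_def sqnorm_ge0 andbT sqnorm_eq0; apply/eqP => /matrixP/(_ (Ordinal m0) (Ordinal m0)).
  by rewrite !mxE eqxx => /eqP; rewrite oner_eq0.
rewrite Psi_fcons trmx1 !mulmx1 [Psi _ _ _]big1 ?addr0 => [|i _]; last by rewrite trmx0 mulmx0.
by rewrite -[X in X <= _]mul1r ler_pM2r // -{1}(expr1n R 2) ler_pXn2r ?nnegrE.
Qed.

(** The value 1 is attained at H_0. *)
Lemma cb_kappa : cb_norm kappa = 1%:E.
Proof.
apply/eqP; rewrite eq_le; apply/andP; split.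
  apply: ge_ereal_sup => _ [m [X [X1 ->]]].
  move: X1; rewrite (mx_delta X) map_kappa => X1.
  by apply: le_trans X1; apply: dual_norm_le.
apply: ge_of_le_bounds ltr01 _ => c c0 hc; apply: (@bndD_unit_ge1 1) => //.
pose U : 'I_n.+1 -> 'M[K]_1 := fcons 1%:M (fun=> 0).
have bU : bndS U 1 by exact: bndS_unit.
have : (os_norm (tens_sum U delta : 'M[dual S]_1) <= c%:E)%E.
  apply: le_trans hc; apply: ereal_sup_ubound; exists 1%N, (tens_sum U gen).
  by rewrite map_kappa; split=> //; apply/os_norm_gen => //; rewrite expr1n.
by move/(os_norm_delta _ c0); apply; exact: bndS_unit.
Qed.

(** The value 2 is attained at H_0 + H_j.  With A its coefficients, the block family
    [[A, A], [A, A]] is positive, being the congruence of A by the row [1 1], and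
    this bounds the dual norm of A by 1. *)
Lemma cb_kappa_inv : cb_norm g = 2%:E.
Proof.
have [j _] : exists j : 'I_n, True by exists (Ordinal n_gt0).
apply/eqP; rewrite eq_le; apply/andP; split.
  apply: ge_ereal_sup => _ [m [X [X1 ->]]].
  move: X1; rewrite (mx_dual_delta X) map_g => X1.
  apply: le_trans (norm_le_double _) _.
  by rewrite -[leRHS]mule1 lee_pmul2l.
apply: ge_of_le_bounds => // c c0 hc.
apply: (bndS_sum_ge2 (j := j)) => //; apply/os_norm_gen => //.
apply: le_trans hc; apply: ereal_sup_ubound.
set A := fcons _ _.
exists 1%N, (tens_sum A delta); rewrite map_g; split=> //.
apply/os_norm_delta => // k B; apply: (bndD_of_posS_block (P := A)) => //.
  by rewrite /A fcons0.
have hA := fcons_herm (adj1 R 1) (delta_herm j).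
have := posS_congr (row_mx 1%:M 1%:M) (posS_sum j).
apply: eq_posS => i; rewrite tr_row_mx map_col_mx -/A hA !adj1 mul_col_mx mul1mx.
by rewrite mul_col_row mulmx1.
Qed.
End Delta.
End SOH.

Theorem theorem3p4 (R : realType) (H : completeNormedModType R[i])
    (d : {dot H for Num.conj}) (n : nat) (e : 'I_n -> H -> H) :
  (forall x : H, `|x| ^+ 2 = d x x) ->
  (1 <= n)%N ->
  (forall i, linear (e i)) ->
  (forall i, continuous (e i)) ->
  OH_basis d e ->
  (exists delta : 'I_n.+1 -> dual (SOH d e),
     forall i j, delta i (SOH_gen d e j) = (i == j)%:R) /\
  forall delta : 'I_n.+1 -> dual (SOH d e),
    (forall i j, delta i (SOH_gen d e j) = (i == j)%:R) ->
    (exists kappa : {linear SOH d e -> dual (SOH d e)},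
       forall i, kappa (SOH_gen d e i) = delta i) /\
    forall kappa : {linear SOH d e -> dual (SOH d e)},
      (forall i, kappa (SOH_gen d e i) = delta i) ->
      (exists kappa_inv : {linear dual (SOH d e) -> SOH d e},
         complete_order_iso kappa kappa_inv /\
         (cb_norm kappa * cb_norm kappa_inv = 2%:E)%E) /\
      forall (m : nat) (A : 'I_n.+1 -> 'M[R[i]]_m),
        (os_norm (tens_sum A delta) <= os_norm (tens_sum A (SOH_gen d e)) <=
         2%:E * os_norm (tens_sum A delta))%E.
Proof.
move=> hd n_gt0 lin_e _ OH.
have e_adj i x y : d (e i x) y = d x (adjoint d (e i) y).
  exact: (adjoint_ex hd (lin_e i) ler01 (OH_gen_contraction lin_e OH i)).
split; first exact: delta_exists.
move=> delta hdelta; split; first exact: kappa_exists.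
move=> kappa hkappa; split.
  have [g hg] := inv_exists d e.
  exists g; split; first exact: (kappa_iso lin_e e_adj OH n_gt0 hdelta).
  rewrite (cb_kappa lin_e e_adj OH n_gt0 hdelta hkappa).
  by rewrite (cb_kappa_inv lin_e e_adj OH n_gt0 hdelta hg) mul1e.
by move=> m A; apply/andP; split; [exact: dual_norm_le|exact: norm_le_double].
Qed.
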